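(* Let $(\kappa,c)$ be a critical pair. (a) $\widetilde W_-(\eta;\kappa,c)$ is a maximal submodule of $V(\eta;\kappa,c)$. (b) $\widetilde W_+(\eta;\kappa,c)$ is a minimal submodule of $V(\eta;\kappa,c)$. (c) If $n_+=n_-$, then $\widetilde W_+(\eta;\kappa,c)$ is the unique nonzero proper submodule of $V(\eta;\kappa,c)$; in particular $V(\eta;\kappa,c)$ admits a unique composition series $0\subset\widetilde W_+(\eta;\kappa,c)=\widetilde W_-(\eta;\kappa,c)\subset V(\eta;\kappa,c)$. (d) If $n_-<n_+$, then $\widetilde W_+(\eta;\kappa,c)\subset \widetilde W_-(\eta;\kappa,c)$ are the only two nonzero proper submodules of $V(\eta;\kappa,c)$; in particular $V(\eta;\kappa,c)$ admits a unique composition series $0\subset\widetilde W_+(\eta;\kappa,c)\subset \widetilde W_-(\eta;\kappa,c)\subset V(\eta;\kappa,c)$.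
   Context: Let $q\in\mathbb{C}$ be nonzero and not a root of unity, and $U=U_q(\mathfrak{sl}_3)$ the algebra generated by $E_1,E_2,F_1,F_2,K_1^{\pm1},K_2^{\pm1}$ with the Jimbo relations. Put $F_3=F_1F_2-qF_2F_1$, $K=K_1K_2^2$, $C_1=F_1E_1+\frac{qK_1+q^{-1}K_1^{-1}}{(q-q^{-1})^2}$. Let $U^+$ be the subalgebra generated by $E_1,E_2$, $\eta:U^+\to\mathbb{C}$ the algebra homomorphism with $\eta(E_1)=\alpha\neq0$, $\eta(E_2)=0$, and $M(\eta)=U\otimes_{U^+}\mathbb{C}v_\eta$ with $xv_\eta=\eta(x)v_\eta$ for $x\in U^+$. Write $[k]=\frac{q^k-q^{-k}}{q-q^{-1}}$, $[k]!=[k]\cdots[1]$, $[0]!=1$, and $\genfrac{[}{]}{0pt}{}{n}{k}=\frac{[n]!}{[k]![n-k]!}$ for $0\le k\le n$ (0 otherwise). For $n\in\mathbb{Z}_+$, $l\in\mathbb{Z}$, $Q\in\mathbb{C}[K^{\pm1},C_1]$, $u(n,l,Q)=q^{2nl}K_2^l\sum_{k=0}^{n}\sum_{j=0}^{n-k}a_{kj}(n)F_2^{n-k}F_3^kK_2^{2j}K^{-2j-k}Qv_\eta$ with $a_{kj}(n)=(-1)^j\alpha^k(q^2-1)^kq^{j(n-3)}q^{\frac{1}{2}k(2n+2j+k-7)}\genfrac{[}{]}{0pt}{}{n}{k}\genfrac{[}{]}{0pt}{}{n-k}{j}$. For $n\in\mathbb{N}$, $h_n(K,C_1)=q^{3-2n}K+q^{2n-3}K^{-1}-(q-q^{-1})^2C_1$.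 A pair $(\kappa,c)\in\mathbb{C}^2$, $\kappa\ne0$, is critical if $h_n(\kappa,c)=0$ for some $n\in\mathbb{N}$; there are at most two such $n$, and $n_+$, $n_-$ denote the largest and smallest. $J(\kappa,c)$ is the ideal of $\mathbb{C}[K^{\pm1},C_1]$ generated by $K-\kappa$, $C_1-c$; $W(\eta;\kappa,c)=UJ(\kappa,c)v_\eta$, $V(\eta;\kappa,c)=M(\eta)/W(\eta;\kappa,c)$. Set $u_\pm=u(n_\pm,0,1)$, $\bar u_\pm$ its image in $V(\eta;\kappa,c)$, and $\widetilde W_\pm(\eta;\kappa,c)=U\bar u_\pm\subseteq V(\eta;\kappa,c)$. *)

(* Defs.v *)
From HB Require Import structures.
From mathcomp Require Import all_boot all_order all_algebra.
From mathcomp Require Import reals complex.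
Set Implicit Arguments. Unset Strict Implicit. Unset Printing Implicit Defensive.
Import Order.TTheory GRing.Theory Num.Theory.
Local Open Scope ring_scope.

Section UqSl3.
Variable C : fieldType.

Definition lin (U W : lmodType C) (f : U -> W) : Prop :=
  forall (a : C) (x y : U), f (a *: x + y) = a *: f x + f y.

Record Uops (V : lmodType C) := Uop {
  E1 : V -> V; E2 : V -> V; F1 : V -> V; F2 : V -> V;
  K1 : V -> V; K1i : V -> V; K2 : V -> V; K2i : V -> V }.

Section Module.
Variables (q : C) (V : lmodType C) (A : Uops V).
Local Notation E1 := (E1 A). Local Notation E2 := (E2 A).
Local Notation F1 := (F1 A). Local Notation F2 := (F2 A).
Local Notation K1 := (K1 A). Local Notation K2 := (K2 A).
Local Notation K1i := (K1i A). Local Notation K2i := (K2i A).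

(* V is a U_q(sl_3)-module: the generators act linearly and satisfy the
   Jimbo relations (Cartan matrix a11=a22=2, a12=a21=-1). *)
Record Uq_module : Prop := {
  lin_E1 : lin E1; lin_E2 : lin E2; lin_F1 : lin F1; lin_F2 : lin F2;
  lin_K1 : lin K1; lin_K1i : lin K1i; lin_K2 : lin K2; lin_K2i : lin K2i;
  K1K1i : forall x, K1 (K1i x) = x; K1iK1 : forall x, K1i (K1 x) = x;
  K2K2i : forall x, K2 (K2i x) = x; K2iK2 : forall x, K2i (K2 x) = x;
  K1K2 : forall x, K1 (K2 x) = K2 (K1 x);
  K1E1 : forall x, K1 (E1 (K1i x)) = q ^+ 2 *: E1 x;
  K1E2 : forall x, K1 (E2 (K1i x)) = q^-1 *: E2 x;
  K2E1 : forall x, K2 (E1 (K2i x)) = q^-1 *: E1 x;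
  K2E2 : forall x, K2 (E2 (K2i x)) = q ^+ 2 *: E2 x;
  K1F1 : forall x, K1 (F1 (K1i x)) = q ^- 2 *: F1 x;
  K1F2 : forall x, K1 (F2 (K1i x)) = q *: F2 x;
  K2F1 : forall x, K2 (F1 (K2i x)) = q *: F1 x;
  K2F2 : forall x, K2 (F2 (K2i x)) = q ^- 2 *: F2 x;
  E1F1 : forall x, E1 (F1 x) - F1 (E1 x) = (q - q^-1)^-1 *: (K1 x - K1i x);
  E2F2 : forall x, E2 (F2 x) - F2 (E2 x) = (q - q^-1)^-1 *: (K2 x - K2i x);
  E1F2 : forall x, E1 (F2 x) = F2 (E1 x);
  E2F1 : forall x, E2 (F1 x) = F1 (E2 x);
  SerreE12 : forall x,
    E1 (E1 (E2 x)) - (q + q^-1) *: E1 (E2 (E1 x)) + E2 (E1 (E1 x)) = 0;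
  SerreE21 : forall x,
    E2 (E2 (E1 x)) - (q + q^-1) *: E2 (E1 (E2 x)) + E1 (E2 (E2 x)) = 0;
  SerreF12 : forall x,
    F1 (F1 (F2 x)) - (q + q^-1) *: F1 (F2 (F1 x)) + F2 (F1 (F1 x)) = 0;
  SerreF21 : forall x,
    F2 (F2 (F1 x)) - (q + q^-1) *: F2 (F1 (F2 x)) + F1 (F2 (F2 x)) = 0 }.

Definition Kop (x : V) := K1 (K2 (K2 x)).
Definition Kinv (x : V) := K1i (K2i (K2i x)).
Definition F3 (x : V) := F1 (F2 x) - q *: F2 (F1 x).
Definition C1op (x : V) :=
  F1 (E1 x) + (q - q^-1) ^- 2 *: (q *: K1 x + q^-1 *: K1i x).

Definition highest_rel (alpha kappa c : C) (v : V) : Prop :=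
  [/\ E1 v = alpha *: v, E2 v = 0, Kop v = kappa *: v & C1op v = c *: v].

Definition submod (S : V -> Prop) : Prop :=
  [/\ S 0, (forall x y, S x -> S y -> S (x + y)),
      (forall (a : C) x, S x -> S (a *: x)),
      (forall x, S x -> [/\ S (E1 x), S (E2 x), S (F1 x) & S (F2 x)]) &
      (forall x, S x -> [/\ S (K1 x), S (K1i x), S (K2 x) & S (K2i x)])].

Definition gen (x : V) : V -> Prop :=
  fun y => forall S, submod S -> S x -> S y.

Definition psubset (S T : V -> Prop) := forall y, S y -> T y.
Definition pequiv (S T : V -> Prop) := forall y, S y <-> T y.

Definition is_maximal (S : V -> Prop) : Prop :=
  [/\ submod S, (exists y, ~ S y) &
      forall T, submod T -> psubset S T -> pequiv T S \/ (forall y, T y)].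

Definition is_minimal (S : V -> Prop) : Prop :=
  [/\ submod S, (exists y, S y /\ y <> 0) &
      forall T, submod T -> psubset T S -> pequiv T (fun y => y = 0) \/ pequiv T S].

Definition nonzero_proper (T : V -> Prop) : Prop :=
  [/\ submod T, (exists y, T y /\ y <> 0) & (exists y, ~ T y)].
End Module.

Definition Umorph (V W : lmodType C) (A : Uops V) (B : Uops W) (f : V -> W) :=
  [/\ lin f,
      (forall x, [/\ f (E1 A x) = E1 B (f x), f (E2 A x) = E2 B (f x),
                     f (F1 A x) = F1 B (f x) & f (F2 A x) = F2 B (f x)]) &
      (forall x, [/\ f (K1 A x) = K1 B (f x), f (K1i A x) = K1i B (f x),
                     f (K2 A x) = K2 B (f x) & f (K2i A x) = K2i B (f x)])].

(* (V, A, v) is (isomorphic to) V(eta;kappa,c) = M(eta)/U J(kappa,c) v_eta with v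
   the image of v_eta: V is the U-module generated by v subject exactly to
   E1 v = alpha v, E2 v = 0, (K - kappa) v = 0, (C1 - c) v = 0
   (universal property of the cyclic module U/(U(E1-alpha)+U E2+U(K-kappa)+U(C1-c))). *)
Definition is_V (q alpha kappa c : C) (V : lmodType C) (A : Uops V) (v : V) : Prop :=
  [/\ highest_rel q A alpha kappa c v,
      (forall y, gen A v y) &
      (forall (W : lmodType C) (B : Uops W), Uq_module q B ->
         forall w : W, highest_rel q B alpha kappa c w ->
         exists f : V -> W, Umorph A B f /\ f v = w)].

Definition qnum (q : C) (k : nat) : C := (q ^+ k - q ^- k) / (q - q^-1).
Definition qfact (q : C) (n : nat) : C := \prod_(1 <= i < n.+1) qnum q i.
Definition qbinom (q : C) (n k : nat) : C :=
  if (k <= n)%N then qfact q n / (qfact q k * qfact q (n - k)) else 0.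

(* a_{kj}(n); the exponent k(2n+2j+k-7)/2 is always an integer (exact division) *)
Definition acoef (q alpha : C) (n k j : nat) : C :=
  (-1) ^+ j * alpha ^+ k * (q ^+ 2 - 1) ^+ k
  * q ^ (j%:Z * (n%:Z - 3))
  * q ^ (divz (k%:Z * (2 * n%:Z + 2 * j%:Z + k%:Z - 7)) 2)
  * qbinom q n k * qbinom q (n - k) j.

Definition u_vec (q alpha : C) (V : lmodType C) (A : Uops V) (n : nat) (v : V) : V :=
  \sum_(k < n.+1) \sum_(j < (n - k).+1)
     acoef q alpha n k j *: iter (n - k) (F2 A)
        (iter k (F3 q A) (iter (2 * j) (K2 A) (iter (2 * j + k) (Kinv A) v))).

Definition hn (q kappa c : C) (n : nat) : C :=
  q ^ (3 - 2 * n%:Z) * kappa + q ^ (2 * n%:Z - 3) * kappa^-1 - (q - q^-1) ^+ 2 * c.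
End UqSl3.

(* Main.v *)
Require Import Defs.
From HB Require Import structures.
From mathcomp Require Import all_boot all_order all_algebra.
From mathcomp Require Import boolp functions ring.
From mathcomp Require Import reals complex.
Import Order.TTheory GRing.Theory Num.Theory.
Set Implicit Arguments. Unset Strict Implicit. Unset Printing Implicit Defensive.
Local Open Scope ring_scope.

(* Put X = (q - q^-1)^2 C_1 and w_n = F_2^n v.  The vectors K_2^l f(X) w_n, with f a polynomial,
   span V, and the weights (n, l) are separated by the eigenvalues of K and E_1; hence a submodule
   S is determined by the ideals I_n(S) = {f | f(X) w_n in S} of C[x].

   Substitute x = y + 1/y.  Writing C[y, 1/y] as a free module of rank two over C[x], stability
   under F_2 and E_2 says that f in I_n implies that both coordinates of phi_n(y) f(y/q) lie in
   I_{n+1}, and those of (y - e_n) f(y/q) in I_{n-1}, where phi_n(y) is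
   (y - y_0 q^{-n-1}) (y - y_0^-1 q^{-n-1}) up to a unit, X v = (y_0 + 1/y_0) v and
   e_n = q^{n-2} / kappa.  An explicit PBW model shows that I_n(0) is generated by
   P_n = prod_{j <= n} (x - x_j) where x_j is the value of x at y = y_0 q^{2j-n}.  When m is
   critical one may take y_0 = q^{3-2m} kappa, and u(m,0,1) is then a multiple of
   (P_m / (x - x_m))(X) w_m.

   Comparing zeros in y, without any genericity assumption on y_0, gives everything: the first
   degree in which a nonzero submodule lives is 0 or a critical m, and in the second case it
   contains u(m,0,1); and if it vanishes below degree m, then I_n(S) is contained in the ideal
   generated by prod_{j < m} (x - x_j), which is I_n of the submodule generated by u(m,0,1). *)

(** * An explicit model of the universal module *)

Section PBWModel.
Variable C : numClosedFieldType.
Variables q alpha kappa c : C.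
Hypotheses (q0 : q != 0) (q2 : q ^+ 2 - 1 != 0) (alpha0 : alpha != 0)
  (kappa0 : kappa != 0).

(* [g l a b] is the coefficient of K_2^l F_2^a G^b v, where G = X F_2 - q F_2 X and
   X = (q - q^-1)^2 C_1.  On the span of the F_2^a G^b v, [mX] is X, and E_2 acts as
   K_2 [mYp] + K_2^-1 [mYm].  The formulas extend to all integers a and b, and the factors
   [a] and [b] keep the lowering operators from leaving the quadrant a, b >= 0, so that no
   boundary conditions are needed. *)
Definition mcarrier : lmodType C := (int -> int -> int -> C^o) : lmodType C.

Local Notation d := (q - q^-1).
Definition mbr (t : C) := (t - t^-1) / (q - q^-1).

Definition mX (g : mcarrier) : mcarrier := fun l a b =>
  (q - q^-1) ^+ 2 * c * (q ^ a / q ^ b) * g l a b + mbr (q ^ (a + 1)) * g l (a + 1) (b - 1)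
  - (q - q^-1) ^+ 2 * (q ^ a / q ^ b / q) * mbr (q ^ (b + 1)) * g l (a - 1) (b + 1).
Definition mYm (g : mcarrier) : mcarrier := fun l a b =>
  - (q ^ a)^-1 * mbr (q ^ (a + 1)) / (q - q^-1) * g l (a + 1) b
  + kappa * q / (q ^ a) ^+ 2 / (q ^ b) ^+ 2 * mbr (q ^ (b + 1)) * g l a (b + 1).
Definition mYp (g : mcarrier) : mcarrier := fun l a b =>
  q ^ a * mbr (q ^ (a + 1)) / (q - q^-1) * g l (a + 1) b
  + mbr (q ^ (b + 1)) * (kappa^-1 * (q ^ a) ^+ 2 * (q ^ b) ^+ 2 / q - (q - q^-1) ^+ 2 * c * (q ^ a) ^+ 2)
    * g l a (b + 1)
  + (q - q^-1) ^+ 2 * ((q ^ a) ^+ 2 / q) * mbr (q ^ (b + 1 + 1)) * mbr (q ^ (b + 1))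
    * g l (a - 1) (b + 1 + 1).
Definition mK2 (g : mcarrier) : mcarrier := fun l a b => g (l - 1) a b.
Definition mK2i (g : mcarrier) : mcarrier := fun l a b => g (l + 1) a b.
Definition mK1 (g : mcarrier) : mcarrier := fun l a b =>
  kappa / (q ^ a * q ^ b) ^+ 3 * g (l + 1 + 1) a b.
Definition mK1i (g : mcarrier) : mcarrier := fun l a b =>
  (q ^ a * q ^ b) ^+ 3 / kappa * g (l - 1 - 1) a b.
Definition mE1 (g : mcarrier) : mcarrier := fun l a b => alpha * q ^ l * g l a b.
Definition mF2 (g : mcarrier) : mcarrier := fun l a b => (q ^ l) ^+ 2 * g l (a - 1) b.
(** [F1] is forced by X = (q - q^-1)^2 F_1 E_1 + q K_1 + q^-1 K_1^-1, since [mE1] is diagonal with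
    nonzero entries alpha q^l and can be divided out. *)
Definition mF1 (g : mcarrier) : mcarrier := fun l a b =>
  (alpha * (q - q^-1) ^+ 2 * q ^ l)^-1 *
  (mX g l a b - kappa / (q * (q ^ a * q ^ b) ^+ 3) * g (l + 1 + 1) a b
   - q * (q ^ a * q ^ b) ^+ 3 / kappa * g (l - 1 - 1) a b).
Definition mE2 (g : mcarrier) : mcarrier := fun l a b =>
  (q ^ (l - 1)) ^- 2 * mYp g (l - 1) a b + (q ^ (l + 1)) ^- 2 * mYm g (l + 1) a b.

Definition mops : Uops mcarrier := Uop mE1 mE2 mF1 mF2 mK1 mK1i mK2 mK2i.

Lemma mqS (i : int) : q ^ (i + 1) = q ^ i * q.
Proof. by rewrite expfzDr // expr1z. Qed.
Lemma mqP (i : int) : q ^ (i - 1) = q ^ i / q.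
Proof. by rewrite expfzDr // -invr_expz expr1z. Qed.
Lemma mq_neq0 (i : int) : q ^ i != 0.
Proof. by rewrite expfz_neq0. Qed.
Lemma md0 : q - q^-1 != 0.
Proof. by apply: contraNneq q2 => e; rewrite expr2 -[X in _ - X](divff q0) -mulrBr e mulr0. Qed.

Lemma mfun3 (f g : mcarrier) : (forall l a b, f l a b = g l a b) -> f = g.
Proof. by move=> e; apply/funext => l; apply/funext => a; apply/funext => b. Qed.

Lemma mlinE (a : C) (f g : mcarrier) i j k : (a *: f + g) i j k = a * f i j k + g i j k.
Proof. by []. Qed.
Lemma mZE (a : C) (f : mcarrier) i j k : (a *: f) i j k = a * f i j k.
Proof. by []. Qed.
Lemma mDE (f g : mcarrier) i j k : (f + g) i j k = f i j k + g i j k.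
Proof. by []. Qed.
Lemma mNE (f : mcarrier) i j k : (- f) i j k = - f i j k.
Proof. by []. Qed.
Lemma m0E i j k : (0 : mcarrier) i j k = 0.
Proof. by []. Qed.

Ltac mgen l a b :=
  move: (mq_neq0 l) (mq_neq0 a) (mq_neq0 b);
  move: (q ^ l) (q ^ a) (q ^ b) => L A B L0 A0 B0.
Ltac mred := rewrite ?(mlinE, mZE, mDE, mNE, m0E);
 rewrite /mE1 /mE2 /mF1 /mF2 /mK1 /mK1i /mK2 /mK2i /mX /mYp /mYm;
 rewrite ?(mlinE, mZE, mDE, mNE, m0E) ?(addrK, subrK); rewrite /mbr ?(mqS, mqP).

Ltac mside := rewrite -?expr2;
  repeat match goal with H : is_true (_ != _) |- _ => rewrite ?H /=; clear H end; done.
Ltac mfield := field; mside.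

Lemma m_E1F1 x : mE1 (mF1 x) - mF1 (mE1 x) = (q - q^-1)^-1 *: (mK1 x - mK1i x).
Proof. apply: mfun3 => l a b; mred; mgen l a b; mfield. Qed.
Lemma m_E2F2 x : mE2 (mF2 x) - mF2 (mE2 x) = (q - q^-1)^-1 *: (mK2 x - mK2i x).
Proof. apply: mfun3 => l a b; mred; mgen l a b; mfield. Qed.
Lemma m_E2F1 x : mE2 (mF1 x) = mF1 (mE2 x).
Proof. apply: mfun3 => l a b; mred; mgen l a b; mfield. Qed.
Lemma m_SerreE12 x : mE1 (mE1 (mE2 x)) - (q + q^-1) *: mE1 (mE2 (mE1 x)) + mE2 (mE1 (mE1 x)) = 0.
Proof. apply: mfun3 => l a b; mred; mgen l a b; mfield. Qed.
Lemma m_SerreE21 x : mE2 (mE2 (mE1 x)) - (q + q^-1) *: mE2 (mE1 (mE2 x)) + mE1 (mE2 (mE2 x)) = 0.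
Proof. apply: mfun3 => l a b; mred; mgen l a b; mfield. Qed.
Lemma m_SerreF12 x : mF1 (mF1 (mF2 x)) - (q + q^-1) *: mF1 (mF2 (mF1 x)) + mF2 (mF1 (mF1 x)) = 0.
Proof. apply: mfun3 => l a b; mred; mgen l a b; mfield. Qed.
Lemma m_SerreF21 x : mF2 (mF2 (mF1 x)) - (q + q^-1) *: mF2 (mF1 (mF2 x)) + mF1 (mF2 (mF2 x)) = 0.
Proof. apply: mfun3 => l a b; mred; mgen l a b; mfield. Qed.

Lemma mops_Uq_module : Uq_module q mops.
Proof.
have gl : forall (f : mcarrier -> mcarrier),
  (forall a x y l m n, f (a *: x + y) l m n = a * f x l m n + f y l m n) -> lin f.
  by move=> f H a x y; apply: mfun3 => l m n; rewrite mlinE.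
split; rewrite /mops /=.
- by apply: gl => t x y l a b; mred; mgen l a b; mfield.
- by apply: gl => t x y l a b; mred; mgen l a b; mfield.
- by apply: gl => t x y l a b; mred; mgen l a b; mfield.
- by apply: gl => t x y l a b; mred; mgen l a b; mfield.
- by apply: gl => t x y l a b; mred; mgen l a b; mfield.
- by apply: gl => t x y l a b; mred; mgen l a b; mfield.
- by apply: gl => t x y l a b; mred; mgen l a b; mfield.
- by apply: gl => t x y l a b; mred; mgen l a b; mfield.
- move=> x; apply: mfun3 => l a b; mred; mgen l a b; mfield.
- move=> x; apply: mfun3 => l a b; mred; mgen l a b; mfield.
- move=> x; apply: mfun3 => l a b; mred; mgen l a b; mfield.
- move=> x; apply: mfun3 => l a b; mred; mgen l a b; mfield.
- move=> x; apply: mfun3 => l a b; mred; mgen l a b; mfield.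
- move=> x; apply: mfun3 => l a b; mred; mgen l a b; mfield.
- move=> x; apply: mfun3 => l a b; mred; mgen l a b; mfield.
- move=> x; apply: mfun3 => l a b; mred; mgen l a b; mfield.
- move=> x; apply: mfun3 => l a b; mred; mgen l a b; mfield.
- move=> x; apply: mfun3 => l a b; mred; mgen l a b; mfield.
- move=> x; apply: mfun3 => l a b; mred; mgen l a b; mfield.
- move=> x; apply: mfun3 => l a b; mred; mgen l a b; mfield.
- move=> x; apply: mfun3 => l a b; mred; mgen l a b; mfield.
- exact: m_E1F1.
- exact: m_E2F2.
- move=> x; apply: mfun3 => l a b; mred; mgen l a b; mfield.
- exact: m_E2F1.
- exact: m_SerreE12.
- exact: m_SerreE21.
- exact: m_SerreF12.
- exact: m_SerreF21.
Qed.

Definition mv : mcarrier := fun l a b => ((l == 0) && (a == 0) && (b == 0))%:R.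

Lemma mC1opE x : (q - q^-1) ^+ 2 *: C1op q mops x = mX x.
Proof. apply: mfun3 => l a b; rewrite /C1op /=; mred; mgen l a b; mfield. Qed.

Lemma mv_highest : highest_rel q mops alpha kappa c mv.
Proof.
have s0 (i : int) : i + 1 = 0 -> q ^ i = q^-1.
  by move=> e; rewrite -(addrK 1 i) e mqP expr0z mul1r.
have s1 (i : int) : i - 1 = 0 -> q ^ i = q.
  by move=> e; rewrite -(subrK 1 i) e mqS expr0z mul1r.
have b0 i : i + 1 = 0 -> mbr (q ^ (i + 1)) = 0.
  by move=> ->; rewrite /mbr expr0z invr1 subrr mul0r.
have X0 : mX mv = ((q - q^-1) ^+ 2 * c) *: mv.
  apply: mfun3 => l a b; rewrite /mX /mv mZE.
  rewrite /mv; case: (l =P 0) => _; last by rewrite /= !mulr0 subr0 addr0.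
  case: (a + 1 =P 0) => [a1|_]; case: (b + 1 =P 0) => [b1|_];
    rewrite ?(b0 a a1) ?(b0 b b1) ?andbF ?mulr0 ?mul0r ?addr0 ?subr0;
    (case: (a =P 0) => [->|]; case: (b =P 0) => [->|]; rewrite ?mulr0 //= ?expr0z ?divr1 ?mulr1 //).
split.
- apply: mfun3 => l a b; rewrite /= /mE1 /mv mZE.
  by case: (l =P 0) => [->|]; rewrite ?expr0z ?mulr1 //= !mulr0.
- apply: mfun3 => l a b; rewrite /= /mE2 /mYp /mYm /mv m0E.
  case: (a + 1 =P 0) => [a1|_]; case: (b + 1 =P 0) => [b1|_]; case: (b + 1 + 1 =P 0) => [b2|_];
    by rewrite ?(b0 a a1) ?(b0 b b1) ?(b0 _ b2) ?andbF ?(mulr0, mul0r, addr0).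
- apply: mfun3 => l a b; rewrite /Kop /=; mred; rewrite /mv.
  case: (a =P 0) => [->|]; case: (b =P 0) => [->|]; rewrite ?andbF ?mulr0 //=.
  by rewrite expr0z mulr1 expr1n divr1.
- have := mC1opE mv; rewrite X0 -scalerA => /(scalerI _); apply.
  by rewrite expf_neq0 // md0.
Qed.

(** Triangularity: applying X to X^i F_2^n v raises the top power of G by one, with factor [n - i].
    This makes w_n, X w_n, ..., X^n w_n independent. *)
Lemma mX_iter_F2 n i : (forall m, (0 < m)%N -> q ^+ m != 1) -> (i <= n)%N ->
  iter i mX (iter n mF2 mv) 0 (n%:Z - i%:Z) i%:Z != 0 /\
  (forall j, (i < j)%N -> iter i mX (iter n mF2 mv) 0 (n%:Z - j%:Z) j%:Z = 0).
Proof.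
move=> qr; elim: i => [_|i IH lin_].
  have E l a b : iter n mF2 mv l a b = (q ^ l) ^+ (2 * n) * mv l (a - n%:Z) b.
    elim: n l a b => [|n IHn] l a b; first by rewrite muln0 mul1r subr0.
    rewrite iterS /mF2 IHn mulrA -exprD -mulnS; congr (_ * mv _ _ _).
    by rewrite intS; ring.
  split=> [|[|j] // _]; rewrite /= E /mv /= expr0z expr1n mul1r.
    by rewrite subr0 subrr eqxx oner_eq0.
  by rewrite andbF.
have [n0 z0] := IH (ltnW lin_); split=> [|j lj]; rewrite iterS {1}/mX.
  rewrite (z0 i.+1) // mulr0 add0r.
  have -> : (n%:Z - i.+1%:Z + 1 = n%:Z - i%:Z)%R by rewrite intS; ring.
  have -> : (i.+1%:Z - 1 = i%:Z)%R by rewrite intS; ring.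
  have -> : (n%:Z - i.+1%:Z - 1 = n%:Z - i.+2%:Z)%R by rewrite (intS i.+1); ring.
  have -> : (i.+1%:Z + 1 = i.+2%:Z)%R by rewrite (intS i.+1); ring.
  rewrite (z0 i.+2) // mulr0 subr0 mulf_neq0 // /mbr mulf_neq0 ?invr_neq0 ?md0 //.
  rewrite subzn ?(ltnW lin_) //; have: q ^+ (2 * (n - i)) != 1.
    by rewrite qr // muln_gt0 subn_gt0 lin_.
  apply: contraNneq => e; move: (mq_neq0 (n - i)%:Z) => t0.
  have -> : q ^+ (2 * (n - i)) = (q ^ (n - i)%:Z - (q ^ (n - i)%:Z)^-1) * q ^ (n - i)%:Z + 1.
    by rewrite mulrBl mulVf // subrK -expr2 mulnC exprM -exprnP.
  by rewrite e mul0r add0r.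
case: j lj => // j lj.
have -> : (n%:Z - j.+1%:Z + 1 = n%:Z - j%:Z)%R by rewrite intS; ring.
have -> : (j.+1%:Z - 1 = j%:Z)%R by rewrite intS; ring.
have -> : (n%:Z - j.+1%:Z - 1 = n%:Z - j.+2%:Z)%R by rewrite (intS j.+1); ring.
have -> : (j.+1%:Z + 1 = j.+2%:Z)%R by rewrite (intS j.+1); ring.
rewrite !z0 ?mulr0 ?subr0 ?addr0 //; first exact: ltnW (ltnW _).
exact: ltnW.
Qed.
End PBWModel.

(** * Laurent polynomials over the symmetric ones *)

Section SymmetricLaurent.
Variable C : numClosedFieldType.
Implicit Types (y z : C) (a b f g : {poly C}).

Definition inv_sum y : C := y + y^-1.

Lemma inv_sum_inv y : inv_sum y^-1 = inv_sum y.
Proof. by rewrite /inv_sum invrK addrC. Qed.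

Lemma inv_sum_surj (x : C) : exists2 y, y != 0 & inv_sum y = x.
Proof.
pose s := sqrtC (x ^+ 2 - 4); have s2 : s ^+ 2 = x ^+ 2 - 4 by rewrite sqrtCK.
have e : (x + s) / 2 * ((x - s) / 2) = 1.
  have -> : (x + s) / 2 * ((x - s) / 2) = (x ^+ 2 - s ^+ 2) / 4 by field.
  by rewrite s2; field.
have y0 : (x + s) / 2 != 0.
  by apply: contra_eqN e => /eqP->; rewrite mul0r eq_sym oner_eq0.
exists ((x + s) / 2) => //; rewrite /inv_sum.
have -> : ((x + s) / 2)^-1 = (x - s) / 2 by rewrite -[RHS](mulKf y0) e mulr1.
by field.
Qed.

Lemma inv_sum_eq y z : y != 0 -> z != 0 -> (inv_sum y == inv_sum z) = (y == z) || (y * z == 1).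
Proof.
move=> y0 z0; rewrite -subr_eq0 -[y == z]subr_eq0 -[y * z == 1]subr_eq0 -mulf_eq0.
have -> : inv_sum y - inv_sum z = (y - z) * (y * z - 1) / (y * z) by rewrite /inv_sum; field; rewrite y0 z0.
by rewrite !mulf_eq0 invr_eq0 !mulf_eq0 (negPf y0) (negPf z0) !orbF.
Qed.

(** Multiplying f by the product of the x - z, z in s, gives a polynomial vanishing everywhere, and
    characteristic zero supplies enough points. *)
Lemma poly_eq0_cofinite (s : seq C) f : (forall x, x \notin s -> f.[x] = 0) -> f = 0.
Proof.
move=> H; pose p := f * \prod_(z <- s) ('X - z%:P).
have p0 x : root p x.
  rewrite /root hornerM; have [xs|xs] := boolP (x \in s); last by rewrite H ?mul0r.
  apply/eqP; suff -> : (\prod_(z <- s) ('X - z%:P)).[x] = 0 by rewrite mulr0.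
  by apply/eqP; rewrite -/(root _ _) root_prod_XsubC.
have: p = 0.
  apply: (@roots_geq_poly_eq0 _ p [seq i%:R | i <- iota 0 (size p)]).
  - by apply/allP => x _; apply: p0.
  - rewrite map_inj_uniq ?iota_uniq // => i j /eqP.
    by rewrite eqr_nat => /eqP.
  - by rewrite size_map size_iota.
move/eqP; rewrite mulf_eq0 => /orP[/eqP//|].
by rewrite prodf_seq_eq0 => /hasP[z _]; rewrite polyXsubC_eq0.
Qed.

(* [a] and [b] are the coordinates of a Laurent polynomial in [y] over the subring of
   polynomials in [y + 1/y], in the basis [1, y]. *)
Lemma comp_uniq (s : seq C) a b a' b' :
  (forall y, y != 0 -> y \notin s ->
     a.[inv_sum y] + y * b.[inv_sum y] = a'.[inv_sum y] + y * b'.[inv_sum y]) ->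
  a = a' /\ b = b'.
Proof.
move=> H; suff: a - a' = 0 /\ b - b' = 0.
  by case=> /eqP; rewrite subr_eq0 => /eqP-> /eqP; rewrite subr_eq0 => /eqP->.
(* The two values at x are determined by the equations at y and 1/y, which are independent unless y
   = 1/y, that is, x = 2 or x = -2. *)
suff K x : x \notin [:: 2, -2 & map inv_sum s] -> (b - b').[x] = 0 /\ (a - a').[x] = 0.
  by split; apply: (@poly_eq0_cofinite [:: 2, -2 & map inv_sum s]) => x /K [].
have [y y0 <-] := inv_sum_surj x; rewrite !inE !negb_or => /and3P[n2 nm2 ns].
have ys : y \notin s by apply: contra ns => /(map_f inv_sum).
have ys' : y^-1 \notin s by apply: contra ns => /(map_f inv_sum); rewrite inv_sum_inv.
have yi0 : y^-1 != 0 by rewrite invr_eq0.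
have := H _ yi0 ys'; have := H _ y0 ys; rewrite inv_sum_inv !hornerE.
move: a.[_] b.[_] a'.[_] b'.[_] => A B A' B' e1 e2.
have yy : y - y^-1 != 0.
  apply: contraNneq n2 => e.
  have: (y - 1) * (y + 1) = 0.
    have -> : (y - 1) * (y + 1) = (y - y^-1) * y by field.
    by rewrite e mul0r.
  move/eqP; rewrite mulf_eq0 subr_eq0 addr_eq0 => /orP[/eqP->|/eqP ey].
    by rewrite /inv_sum invr1.
  by move: nm2; rewrite ey /inv_sum invrN1 -opprD eqxx.
have eB : B - B' = 0.
  apply: (mulfI yy); rewrite mulr0.
  have -> : (y - y^-1) * (B - B') = (A + y * B - (A' + y * B')) - (A + y^-1 * B - (A' + y^-1 * B')).
    by ring.
  by rewrite e1 e2 !subrr.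
split=> //; have -> : A - A' = (A + y * B - (A' + y * B')) - y * (B - B') by ring.
by rewrite e1 eB subrr mulr0 subrr.
Qed.

Lemma shift_comp (t : C) f : t != 0 ->
  exists a b, forall y, y != 0 -> f.[inv_sum (t * y)] = a.[inv_sum y] + y * b.[inv_sum y].
Proof.
move=> t0; elim/poly_ind: f => [|f c [a [b H]]].
  by exists 0, 0 => y _; rewrite !hornerE ?mulr0 ?addr0.
(* With x = y + 1/y, the value of [inv_sum] at t y is t^-1 x + (t - t^-1) y, and y^2 = x y - 1
   brings the product back to the basis 1, y. *)
exists (t^-1 *: 'X * a - (t - t^-1) *: b + c%:P), ((t - t^-1) *: a + t *: 'X * b) => y y0.
rewrite hornerMXaddC H // !hornerE /inv_sum; field.
by rewrite y0 t0.
Qed.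

Lemma shift_comp2 (t : C) f g : t != 0 ->
  exists a b, forall y, y != 0 ->
    f.[inv_sum (t * y)] + t * y * g.[inv_sum (t * y)] = a.[inv_sum y] + y * b.[inv_sum y].
Proof.
move=> t0; have [a [b H]] := shift_comp f t0; have [a' [b' H']] := shift_comp g t0.
exists (a - t *: b'), (b + t *: (a' + 'X * b')) => y y0.
by rewrite H // H' // !hornerE /inv_sum; field.
Qed.

(** * Partial products of P_n and the shift from y to y / q *)

Section Rung.
Variables (q y0 : C).
Hypotheses (q0 : q != 0) (y00 : y0 != 0).

(** [rung n.+1 n] is P_n, and for m <= n only its first m factors are kept. The degree n is an
    integer so that n - 1 is not truncated. *)
Definition rung (m : nat) (n : int) : {poly C} :=
  \prod_(j < m) ('X - (inv_sum (y0 * q ^ (2 * j%:Z - n)))%:P).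

Lemma rungS m n : rung m.+1 n = rung m n * ('X - (inv_sum (y0 * q ^ (2 * m%:Z - n)))%:P).
Proof. by rewrite /rung big_ord_recr. Qed.

Lemma rung_monic m n : rung m n \is monic.
Proof. by apply: monic_prod => j _; apply: monicXsubC. Qed.

Lemma size_rung m n : size (rung m n) = m.+1.
Proof. by rewrite /rung size_prod_XsubC /index_enum -enumT size_enum_ord. Qed.

Lemma rung_dvd m k n : (k <= m)%N -> rung k n %| rung m n.
Proof.
elim: m => [|m IH]; first by rewrite leqn0 => /eqP->.
rewrite leq_eqVlt => /orP[/eqP-> //|km]; rewrite rungS dvdp_mulr //; exact: IH.
Qed.

Let qz0 n : q ^ n != 0. Proof. exact: expfz_neq0. Qed.

(** Read in y, each factor of [rung m n] vanishes at y0 q^(2j-n) and at its inverse. Passing to y /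
    q multiplies the zeros by q; compared with [rung m (n + 1)], those containing 1/y0 agree and
    those containing y0 move by one index, so that one zero is left over at each end. *)
Lemma rung_up m n y : y != 0 ->
  (rung m n).[inv_sum (y / q)] * (y - y0 * q ^ (- n - 1)) =
  q ^- m * (rung m (n + 1)).[inv_sum y] * (y - y0 * q ^ (2 * m%:Z - n - 1)).
Proof.
move=> yn0; elim: m => [|m IH].
  have -> : 2 * 0%:Z - n - 1 = - n - 1 :> int by ring.
  by rewrite /rung !big_ord0 !hornerE expr0 invr1 !mul1r.
rewrite !rungS !hornerM mulrAC IH.
pose e := 2 * m%:Z - n - 1.
have -> : 2 * m.+1%:Z - n - 1 = 1 + (1 + e) :> int by rewrite /e intS; ring.
have -> : 2 * m%:Z - (n + 1) = e :> int by rewrite /e; ring.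
rewrite -/e; have -> : 2 * m%:Z - n = 1 + e :> int by rewrite /e; ring.
rewrite !(expfzDr 1) // expr1z exprS invfM; have := qz0 e.
move: (_.[_]) (q ^ e) (q ^- m) => r u p u0.
rewrite !hornerXsubC /inv_sum; field; by rewrite yn0 u0 q0 y00.
Qed.

(** The two families exchange roles: the zeros containing y0 agree and those containing 1/y0
    telescope. *)
Lemma rung_down m n y : y != 0 ->
  (rung m n).[inv_sum (y / q)] * (y - q ^ (n + 1 - 2 * m%:Z) / y0) =
  q ^- m * (rung m (n - 1)).[inv_sum y] * (y - q ^ (n + 1) / y0).
Proof.
move=> yn0; elim: m => [|m IH].
  have -> : n + 1 - 2 * 0%:Z = n + 1 :> int by ring.
  by rewrite /rung !big_ord0 !hornerE expr0 invr1 !mul1r.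
rewrite !rungS !hornerM [LHS]mulrAC.
have -> : 2 * m%:Z - (n - 1) = 1 + (2 * m%:Z - n) :> int by ring.
have -> : n + 1 - 2 * m.+1%:Z = - 1 - (2 * m%:Z - n) :> int by rewrite intS; ring.
move: IH; have -> : n + 1 - 2 * m%:Z = 1 - (2 * m%:Z - n) :> int by ring.
rewrite !(expfzDr 1) // !(expfzDr (-1)) // -!invr_expz expr1z exprS invfM.
move: (2 * _ - n) (qz0 (2 * m%:Z - n)) => e e0.
move: (_.[_]) (_.[_]) => r' r; move: (q ^ e) e0 (q ^- m) (q ^ (n + 1)) => u u0 p w IH.
have -> : q^-1 * p * (r' * ('X - (inv_sum (y0 * (q * u)))%:P).[inv_sum y]) * (y - w / y0) =
  r * (y - q / u / y0) * (('X - (inv_sum (y0 * (q * u)))%:P).[inv_sum y] / q).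
  by rewrite IH; ring.
rewrite !hornerXsubC /inv_sum; field; by rewrite yn0 u0 q0 y00.
Qed.

(** With u = q^(-n-1) the bracket is (y - u y0) (y - u / y0) / y. [rung_up] trades y - u y0 for y -
    s, and (y - s) (y - t) / y = (1 - s t) y - (s + t - s t x), where x = y + 1/y, displays both
    coordinates. *)
Lemma rung_climb (m : nat) (n : int) (k : C) a b :
  (forall y, y != 0 ->
     y * a.[inv_sum y] - (1 - q ^+ 2)^-1 * b.[inv_sum y] =
     k * (y - q ^ (- n - 1) * inv_sum y0 + (q ^ (- n - 1)) ^+ 2 / y) * (rung m n).[inv_sum (y / q)]) ->
  let s := y0 * q ^ (2 * m%:Z - n - 1) in let t := q ^ (- n - 1) / y0 in
  a = (k / q ^+ m * (1 - s * t)) *: rung m (n + 1) /\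
  (1 - q ^+ 2)^-1 *: b = (k / q ^+ m) *: (((s + t)%:P - (s * t) *: 'X) * rung m (n + 1)).
Proof.
move=> H s t.
have [y yn0 yt|e1 e2] := @comp_uniq [:: y0 * q ^ (- n - 1)] (- ((1 - q ^+ 2)^-1 *: b)) a
  (- ((k / q ^+ m) *: (((s + t)%:P - (s * t) *: 'X) * rung m (n + 1))))
  ((k / q ^+ m * (1 - s * t)) *: rung m (n + 1)); last first.
  by split=> //; apply: oppr_inj.
have := rung_up m n yn0; rewrite -/s; have := H y yn0.
rewrite !(hornerN, hornerZ, hornerM, hornerD, hornerC, hornerX).
rewrite addrC => ->.
move: (_.[_]) (_.[_]) => r r' e.
have {e} -> : r' = q ^- m * r * (y - s) / (y - y0 * q ^ (- n - 1)).
  by rewrite -e mulfK // subr_eq0; move: yt; rewrite inE.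
move: yt; rewrite inE -subr_eq0 /t /inv_sum.
move: (q ^- m) (qz0 (- n - 1)) (q ^ (- n - 1)) => p _ u yu; field.
by rewrite y00 yn0 yu.
Qed.

(** Here s = y0 q^(n-1) and t = s^-1 q^-2 in [rung_climb]. Subtracting s^-1 times the second
    coordinate leaves a multiple of x - s - s^-1, the next factor of the product. *)
Lemma rung_theta (n : nat) (k : C) a b :
  (forall y, y != 0 ->
     y * a.[inv_sum y] - (1 - q ^+ 2)^-1 * b.[inv_sum y] =
     k * (y - q ^ (- n%:Z - 1) * inv_sum y0 + (q ^ (- n%:Z - 1)) ^+ 2 / y)
       * (rung n n%:Z).[inv_sum (y / q)]) ->
  a - (q ^ (1 - n%:Z) / y0) *: ((1 - q ^+ 2)^-1 *: b) =
  (k / q ^+ n * (q ^ (1 - n%:Z) / y0) / q ^+ 2) *: rung n.+1 (n%:Z + 1).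
Proof.
move=> /rung_climb[-> ->]; rewrite rungS.
have -> : 2 * n%:Z - (n%:Z + 1) = 2 * n%:Z - n%:Z - 1 :> int by ring.
have -> : 2 * n%:Z - n%:Z - 1 = n%:Z - 1 :> int by ring.
have -> : - n%:Z - 1 = (1 - n%:Z) - 2 :> int by ring.
have -> : q ^ (n%:Z - 1) = (q ^ (1 - n%:Z))^-1 by rewrite invr_expz; congr (q ^ _); ring.
have -> : q ^ (1 - n%:Z - 2) = q ^ (1 - n%:Z) / q ^+ 2 by rewrite expfzDr // -invr_expz.
move: (qz0 (1 - n%:Z)) (k / q ^+ n) (rung _ _) => u0 K r.
have: q ^ (1 - n%:Z) / y0 != 0 by rewrite mulf_neq0 ?invr_neq0.
have -> : y0 * (q ^ (1 - n%:Z))^-1 = (q ^ (1 - n%:Z) / y0)^-1 by rewrite invfM invrK mulrC.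
have -> : q ^ (1 - n%:Z) / q ^+ 2 / y0 = q ^ (1 - n%:Z) / y0 / q ^+ 2 by rewrite mulrAC.
move: (q ^ (1 - n%:Z) / y0) => z z0; rewrite mulrA mulVf // mul1r -!mul_polyC /inv_sum.
rewrite !(polyCD, polyCN, polyCM) invrK.
have: (z%:P * (z^-1)%:P = 1 :> {poly C}) by rewrite -polyCM divff.
by move: (z%:P) (z^-1)%:P => Z W ZW; ring: ZW.
Qed.

(** After y is replaced by q y, [rung_down] cancels q y - e and leaves q y - s. Since this is linear
    in y, a nonzero multiple of f is itself one of the two coordinates. *)
Lemma rung_descend (m : nat) (n : int) (N e : C) f a b : N != 0 ->
  e = q ^ (n + 1 - 2 * m%:Z) / y0 ->
  (forall y, y != 0 ->
    N * (y - e) * f.[inv_sum (y / q)] = (rung m (n - 1)).[inv_sum y]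
      * (a.[inv_sum y] + y * b.[inv_sum y])) ->
  rung m n %| f.
Proof.
move=> N0 eE H; have [ta [tb T]] := @shift_comp2 q a b q0.
pose s := q ^ (n + 1) / y0.
(* The excluded point e / q is the zero of the cancelled factor q y - e. *)
have [y yn0 yt|e1 e2] := @comp_uniq [:: e / q] (- (N * s / q ^+ m) *: f) ((N * q / q ^+ m) *: f)
  (rung m n * ta) (rung m n * tb); last first.
  have nz : N * q / q ^+ m != 0 by rewrite !mulf_neq0 ?invr_neq0 ?expf_neq0.
  rewrite -(dvdpZr _ _ nz).
  by rewrite e2 dvdp_mulr.
have qyn0 : q * y != 0 by rewrite mulf_neq0.
have qye : q * y - e != 0.
  by move: yt; rewrite inE subr_eq0; apply: contra => /eqP<-; rewrite mulrAC divff // mul1r.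
have := rung_down m n qyn0; rewrite -eE -/s; have := H _ qyn0; have := T y yn0.
have -> : q * y / q = y by rewrite mulrAC divff ?mul1r.
rewrite !(hornerZ, hornerM) => TT.
have -> (r : C) : r * ta.[inv_sum y] + y * (r * tb.[inv_sum y]) =
    r * (ta.[inv_sum y] + y * tb.[inv_sum y]) by ring.
rewrite -TT; move: (a.[_] + _) (f.[_]) => Z F.
move: ((rung m n).[_]) ((rung m (n - 1)).[_]) => r r' e1 e2.
apply: (mulfI qye).
have -> : (q * y - e) * (r * Z) = r * (q * y - e) * Z by ring.
rewrite e2; have -> : q ^- m * r' * (q * y - s) * Z = q ^- m * (q * y - s) * (r' * Z) by ring.
rewrite -e1; ring.
Qed.

(** Now all of P_{n-1} divides both coordinates. The same cancellation leaves f times (y - eps) (y -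
    Q y0) (y - Q / y0) / y, whose two coordinates have degree one in x. The first divisibility is
    the y-coordinate; the second comes from eliminating x between the two. *)
Lemma rung_first (n : nat) (N e : C) f a b : N != 0 -> e != 0 ->
  (forall y, y != 0 ->
    N * (y - e) * f.[inv_sum (y / q)] = (rung n (n%:Z - 1)).[inv_sum y]
      * (a.[inv_sum y] + y * b.[inv_sum y])) ->
  let eps := e / q in let Q := q ^+ n in
  rung n.+1 n %| f * ('X - (eps + Q * inv_sum y0 - eps * Q ^+ 2)%:P) /\
  rung n.+1 n %| ((Q ^+ 2 - 1) * (1 + eps ^+ 2 * Q ^+ 2 - eps * Q * inv_sum y0)) *: f.
Proof.
move=> N0 e0 H eps Q; have [ta [tb T]] := @shift_comp2 q a b q0.
have Q0 : Q != 0 by rewrite expf_neq0.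
have nz : N * q ^+ 2 / (Q * q) != 0 by rewrite !mulf_neq0 ?invr_neq0 ?mulf_neq0 ?expf_neq0.
have [y yn0 _|e1 e2] := @comp_uniq [::]
  ((N * q ^+ 2 / (Q * q)) *: (f * ((Q ^+ 2 + eps * Q * inv_sum y0 - 1)%:P - (eps * Q ^+ 2) *: 'X)))
  ((N * q ^+ 2 / (Q * q)) *: (f * ('X - (eps + Q * inv_sum y0 - eps * Q ^+ 2)%:P)))
  (rung n.+1 n * ta) (rung n.+1 n * tb); last first.
  have d2 : rung n.+1 n %| f * ('X - (eps + Q * inv_sum y0 - eps * Q ^+ 2)%:P).
    by rewrite -(dvdpZr _ _ nz) e2 dvdp_mulr.
  have d1 : rung n.+1 n %| f * ((Q ^+ 2 + eps * Q * inv_sum y0 - 1)%:P - (eps * Q ^+ 2) *: 'X).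
    by rewrite -(dvdpZr _ _ nz) e1 dvdp_mulr.
  split=> //; have -> : ((Q ^+ 2 - 1) * (1 + eps ^+ 2 * Q ^+ 2 - eps * Q * inv_sum y0)) *: f =
    f * ((Q ^+ 2 + eps * Q * inv_sum y0 - 1)%:P - (eps * Q ^+ 2) *: 'X) +
    (eps * Q ^+ 2) *: (f * ('X - (eps + Q * inv_sum y0 - eps * Q ^+ 2)%:P)).
    rewrite -!mul_polyC; move: (inv_sum y0) => cc; rewrite !(polyCD, polyCN, polyCM, polyC_exp, polyC1).
    by ring.
  by rewrite dvdp_add // dvdpZr // !mulf_neq0 ?invr_neq0 ?expf_neq0.
have qyn0 : q * y != 0 by rewrite mulf_neq0.
have := rung_down n n qyn0; have := H _ qyn0; have := T y yn0.
have -> : q * y / q = y by rewrite mulrAC divff ?mul1r.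
rewrite rungS !(hornerZ, hornerM, hornerXsubC, hornerD, hornerN, hornerC, hornerX) => TT.
have -> (r u : C) : r * u * ta.[inv_sum y] + y * (r * u * tb.[inv_sum y]) =
    r * u * (ta.[inv_sum y] + y * tb.[inv_sum y]).
  by ring.
rewrite -TT.
have -> : 2 * n%:Z - n%:Z = n :> int by ring.
have -> : n%:Z + 1 - 2 * n%:Z = 1 - n%:Z :> int by ring.
rewrite !expfzDr // -!invr_expz !expr1z -!exprnP -/Q.
have -> : e = q * eps by rewrite /eps mulrCA divff ?mulr1.
move: (a.[_] + _) (f.[_]) => Z F.
move: ((rung n _).[_]) ((rung n _).[_]) => r' r e1 e2.
have -> : r' * (inv_sum y - inv_sum (y0 * Q)) * Z =
    r' * (q * y - q / Q / y0) * ((y - y0 * Q) / (q * y)) * Z.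
  by rewrite /inv_sum; field; rewrite yn0 Q0 q0 y00.
rewrite e2.
have -> : Q^-1 * r * (q * y - Q * q / y0) * ((y - y0 * Q) / (q * y)) * Z =
    Q^-1 * (q * y - Q * q / y0) * ((y - y0 * Q) / (q * y)) * (r * Z) by ring.
by rewrite -e1 /inv_sum; field; rewrite yn0 Q0 q0 y00.
Qed.

End Rung.

Lemma rung_rev (q y0 : C) m : rung q y0^-1 m.+1 m = rung q y0 m.+1 m.
Proof.
rewrite /rung (reindex_inj rev_ord_inj) /=; apply: eq_bigr => j _; rewrite subSS.
have -> : 2 * (m - j)%N%:Z - m%:Z = - (2 * j%:Z - m%:Z) :> int.
  by rewrite -subzn; [ring | rewrite -ltnS].
by rewrite -invr_expz -invfM inv_sum_inv.
Qed.
End SymmetricLaurent.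

(** * Linear combinations and polynomials in an operator *)

Section LinearCombinations.
Variables (C : fieldType) (V : lmodType C).

(** Reified linear combinations: comparing coefficients atom by atom leaves scalar equations for
    [ring] and [field]. *)
Inductive lexpr :=
  LVar of nat | LZero | LAdd of lexpr & lexpr | LOpp of lexpr | LScale of C & lexpr.

Fixpoint leval (env : seq V) e : V :=
  match e with
  | LVar i => env`_i
  | LZero => 0
  | LAdd e1 e2 => leval env e1 + leval env e2
  | LOpp e => - leval env e
  | LScale c e => c *: leval env e
  end.

Fixpoint lcoef e (i : nat) : C :=
  match e with
  | LVar j => if eqn i j then 1 else 0
  | LZero => 0
  | LAdd e1 e2 => lcoef e1 i + lcoef e2 i
  | LOpp e => - lcoef e i
  | LScale c e => c * lcoef e i
  end.

Lemma leval_sum env e : leval env e = \sum_(i < size env) lcoef e i *: env`_i.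
Proof.
elim: e => [j||e1 IH1 e2 IH2|e IH|c e IH] /=.
- have [js|js] := ltnP j (size env).
    rewrite (bigD1 (Ordinal js)) //= eqnE eqxx scale1r big1 ?addr0 // => i ij.
    by rewrite ifN ?scale0r // eqnE; apply: contra ij.
  rewrite nth_default // big1 // => i _; rewrite ifN ?scale0r // eqnE.
  by rewrite neq_ltn (leq_trans (ltn_ord i) js).
- by rewrite big1 // => i _; rewrite scale0r.
- by rewrite IH1 IH2 -big_split; apply: eq_bigr => i _; rewrite scalerDl.
- by rewrite IH -sumrN; apply: eq_bigr => i _; rewrite scaleNr.
- by rewrite IH scaler_sumr; apply: eq_bigr => i _; rewrite scalerA.
Qed.

Fixpoint lcoef_all e1 e2 n : Prop :=
  if n is m.+1 then lcoef e1 m = lcoef e2 m /\ lcoef_all e1 e2 m else True.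

Lemma leval_eq env e1 e2 : lcoef_all e1 e2 (size env) -> leval env e1 = leval env e2.
Proof.
move=> H; have K n i : (i < n)%N -> lcoef_all e1 e2 n -> lcoef e1 i = lcoef e2 i.
  by elim: n => // n IH; rewrite ltnS leq_eqVlt => /orP[/eqP->|/IH K] [].
by rewrite !leval_sum; apply: eq_bigr => i _; rewrite (K _ _ (ltn_ord i) H).
Qed.
End LinearCombinations.

Ltac lindex x env :=
  match env with
  | x :: _ => constr:(0%N)
  | _ :: ?e => let i := lindex x e in constr:(S i)
  end.
Ltac lcollect V t env :=
  match t with
  | ?a + ?b => let env := lcollect V a env in lcollect V b env
  | - ?a => lcollect V a env
  | _ *: ?a => lcollect V a env
  | 0 => env
  | _ => match env with
         | _ => let i := lindex t env in env
         | _ => constr:(@cons V t env)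
         end
  end.
Ltac lreify C t env :=
  match t with
  | ?a + ?b => let x := lreify C a env in let y := lreify C b env in constr:(@LAdd C x y)
  | - ?a => let x := lreify C a env in constr:(@LOpp C x)
  | ?c *: ?a => let x := lreify C a env in constr:(@LScale C c x)
  | 0 => constr:(@LZero C)
  | _ => let i := lindex t env in constr:(@LVar C i)
  end.
(* Reduces an identity between linear combinations of vectors to the identities between the
   coefficients of each vector occurring in it. *)
Ltac lincomb C V :=
  match goal with
  | |- @eq _ ?a ?b =>
    let env := lcollect V a (@nil V) in
    let env := lcollect V b env in
    let x := lreify C a env in
    let y := lreify C b env in
    apply: (@leval_eq C V env x y); cbn [lcoef_all size lcoef eqn];
    repeat (split; [ | ]); try exact I
  end.

Section LinearOps.
Variables (C : fieldType) (U W : lmodType C) (f : U -> W).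
Hypothesis fl : lin f.
Lemma linopD x y : f (x + y) = f x + f y.
Proof. by have := fl 1 x y; rewrite !scale1r. Qed.
Lemma linop0 : f 0 = 0.
Proof. by apply: (addrI (f 0)); rewrite -linopD !addr0. Qed.
Lemma linopZ a x : f (a *: x) = a *: f x.
Proof. by have := fl a x 0; rewrite linop0 !addr0. Qed.
Lemma linopN x : f (- x) = - f x.
Proof. by rewrite -scaleN1r linopZ scaleN1r. Qed.
Lemma linop_sum I (r : seq I) (P : pred I) (F : I -> U) :
  f (\sum_(i <- r | P i) F i) = \sum_(i <- r | P i) f (F i).
Proof. exact: (big_morph f linopD linop0). Qed.
End LinearOps.

Section PolyAction.
Variables (C : fieldType) (V : lmodType C) (T : V -> V).
Hypothesis Tl : lin T.
Implicit Types (f g : {poly C}) (x y : V).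

Definition pact (f : {poly C}) (x : V) : V := \sum_(i < size f) f`_i *: iter i T x.

Lemma iter_lin i : lin (iter i T).
Proof. by elim: i => // i IH a x y; rewrite !iterS IH Tl. Qed.

Lemma pactE n f x : (size f <= n)%N -> pact f x = \sum_(i < n) f`_i *: iter i T x.
Proof.
move=> fn; rewrite /pact (big_ord_widen _ (fun i => f`_i *: iter i T x) fn) big_mkcond.
apply: eq_bigr => i _; case: ltnP => // h; by rewrite nth_default ?scale0r.
Qed.

Lemma pactD f g x : pact (f + g) x = pact f x + pact g x.
Proof.
pose n := maxn (size f) (size g).
rewrite !(@pactE n) ?leq_maxl ?leq_maxr ?(leq_trans (size_polyD _ _)) //.
by rewrite -big_split; apply: eq_bigr => i _; rewrite coefD scalerDl.
Qed.

Lemma pactZ a f x : pact (a *: f) x = a *: pact f x.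
Proof.
rewrite (@pactE (size f)) ?size_scale_leq // scaler_sumr.
by apply: eq_bigr => i _; rewrite coefZ scalerA.
Qed.

Lemma pactN f x : pact (- f) x = - pact f x.
Proof. by rewrite -[- f]scaleN1r pactZ scaleN1r. Qed.

Lemma pactC c x : pact c%:P x = c *: x.
Proof. by rewrite (@pactE 1) ?size_polyC_leq1 // big_ord1 coefC eqxx. Qed.

Lemma pact0 x : pact 0 x = 0.
Proof. by rewrite -[0]polyC0 pactC scale0r. Qed.

Lemma pact1 x : pact 1 x = x.
Proof. by rewrite -[1]polyC1 pactC scale1r. Qed.

Lemma pact_lin f : lin (pact f).
Proof.
move=> a x y; rewrite /pact scaler_sumr -big_split; apply: eq_bigr => i _.
by rewrite (iter_lin i) scalerDr !scalerA mulrC.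
Qed.

Lemma pactMX f x : pact (f * 'X) x = T (pact f x).
Proof.
rewrite (@pactE (size f).+1); last first.
  by rewrite (leq_trans (size_polyMleq _ _)) // size_polyX addn2.
rewrite big_ord_recl coefMX eqxx scale0r add0r (linop_sum Tl).
by apply: eq_bigr => i _; rewrite coefMX (linopZ Tl).
Qed.

Lemma pactM f g x : pact (f * g) x = pact f (pact g x).
Proof.
elim/poly_ind: f => [|f c IH]; first by rewrite mul0r !pact0.
rewrite mulrDl !pactD -mulrA ['X * g]mulrC mulrA pactMX IH pactMX mul_polyC pactZ.
by rewrite pactC.
Qed.

Lemma pactX x : pact 'X x = T x.
Proof. by rewrite -['X]mul1r pactMX pact1. Qed.

Lemma pact_ind_commute (S : V -> V) f x : lin S -> (forall y, S (T y) = T (S y)) ->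
  S (pact f x) = pact f (S x).
Proof.
move=> Sl ST; rewrite (linop_sum Sl); apply: eq_bigr => i _; rewrite (linopZ Sl).
by congr (_ *: _); elim: (nat_of_ord i) => // j IH; rewrite !iterS ST IH.
Qed.

Lemma pact_eigen a f x : T x = a *: x -> pact f x = f.[a] *: x.
Proof.
move=> e; elim/poly_ind: f => [|f c IH]; first by rewrite pact0 horner0 scale0r.
by rewrite pactD pactMX IH (linopZ Tl) e pactC hornerMXaddC scalerDl scalerA.
Qed.
End PolyAction.

(** * Commutation relations *)

Section ModuleRelations.
Variables (C : numClosedFieldType) (q : C) (V : lmodType C) (A : Uops V).
Hypotheses (q0 : q != 0) (qroot : forall m, (0 < m)%N -> q ^+ m != 1).
Hypothesis HA : Uq_module q A.
Local Notation E1 := (E1 A). Local Notation E2 := (E2 A).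
Local Notation F1 := (F1 A). Local Notation F2 := (F2 A).
Local Notation K1 := (K1 A). Local Notation K2 := (K2 A).
Local Notation K1i := (K1i A). Local Notation K2i := (K2i A).
Local Notation Kop := (Kop A).
Local Notation d := (q - q^-1).
Implicit Types (x y : V).

Lemma q21_neq0 : q ^+ 2 - 1 != 0.
Proof. by rewrite subr_eq0 qroot. Qed.
Lemma d_neq0 : d != 0.
Proof.
apply: contraNneq q21_neq0 => e; have -> : q ^+ 2 - 1 = d * q by rewrite mulrBl mulVf.
by rewrite e mul0r.
Qed.

Let opD := (linopD (lin_E1 HA), linopD (lin_E2 HA), linopD (lin_F1 HA), linopD (lin_F2 HA),
  linopD (lin_K1 HA), linopD (lin_K1i HA), linopD (lin_K2 HA), linopD (lin_K2i HA)).
Let opZ := (linopZ (lin_E1 HA), linopZ (lin_E2 HA), linopZ (lin_F1 HA), linopZ (lin_F2 HA),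
  linopZ (lin_K1 HA), linopZ (lin_K1i HA), linopZ (lin_K2 HA), linopZ (lin_K2i HA)).
Let opN := (linopN (lin_E1 HA), linopN (lin_E2 HA), linopN (lin_F1 HA), linopN (lin_F2 HA),
  linopN (lin_K1 HA), linopN (lin_K1i HA), linopN (lin_K2 HA), linopN (lin_K2i HA)).
Let op0 := (linop0 (lin_E1 HA), linop0 (lin_E2 HA), linop0 (lin_F1 HA), linop0 (lin_F2 HA),
  linop0 (lin_K1 HA), linop0 (lin_K1i HA), linop0 (lin_K2 HA), linop0 (lin_K2i HA)).
Let lins := (lin_E1 HA, lin_E2 HA, lin_F1 HA, lin_F2 HA, lin_K1 HA, lin_K1i HA, lin_K2 HA, lin_K2i HA).

Lemma conj_comm (K Ki X : V -> V) (t : C) : lin K -> lin Ki -> lin X ->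
  (forall x, Ki (K x) = x) -> t != 0 ->
  (forall x, K (X (Ki x)) = t *: X x) ->
  (forall x, K (X x) = t *: X (K x)) /\ (forall x, Ki (X x) = t^-1 *: X (Ki x)).
Proof.
move=> Kl Kil Xl KiK t0 H; split=> x; first by rewrite -[in LHS](KiK x) H.
apply: (scalerI t0); rewrite scalerA divff // scale1r -(linopZ Kil) -H KiK.
by [].
Qed.

Let qi0 : q^-1 != 0. Proof. by rewrite invr_eq0. Qed.
Let qq0 : q ^+ 2 != 0. Proof. by rewrite expf_neq0. Qed.
Let qqi0 : q ^- 2 != 0. Proof. by rewrite invr_eq0 expf_neq0. Qed.

Let k1e1 := conj_comm (lin_K1 HA) (lin_K1i HA) (lin_E1 HA) (K1iK1 HA) qq0 (K1E1 HA).
Let k1e2 := conj_comm (lin_K1 HA) (lin_K1i HA) (lin_E2 HA) (K1iK1 HA) qi0 (K1E2 HA).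
Let k1f1 := conj_comm (lin_K1 HA) (lin_K1i HA) (lin_F1 HA) (K1iK1 HA) qqi0 (K1F1 HA).
Let k1f2 := conj_comm (lin_K1 HA) (lin_K1i HA) (lin_F2 HA) (K1iK1 HA) q0 (K1F2 HA).
Let k2e1 := conj_comm (lin_K2 HA) (lin_K2i HA) (lin_E1 HA) (K2iK2 HA) qi0 (K2E1 HA).
Let k2e2 := conj_comm (lin_K2 HA) (lin_K2i HA) (lin_E2 HA) (K2iK2 HA) qq0 (K2E2 HA).
Let k2f1 := conj_comm (lin_K2 HA) (lin_K2i HA) (lin_F1 HA) (K2iK2 HA) q0 (K2F1 HA).
Let k2f2 := conj_comm (lin_K2 HA) (lin_K2i HA) (lin_F2 HA) (K2iK2 HA) qqi0 (K2F2 HA).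

Lemma K1iK2 x : K1i (K2 x) = K2 (K1i x).
Proof. by rewrite -[in LHS](K1K1i HA x) -(K1K2 HA) (K1iK1 HA). Qed.
Lemma K1K2i x : K1 (K2i x) = K2i (K1 x).
Proof. by rewrite -[in RHS](K2K2i HA x) (K1K2 HA) (K2iK2 HA). Qed.
Lemma K1iK2i x : K1i (K2i x) = K2i (K1i x).
Proof. by rewrite -[in RHS](K2K2i HA x) K1iK2 (K2iK2 HA). Qed.

(* Rewriting to the order F, E, K2, K1 of PBW words. *)
Let kk := (K1K1i HA, K1iK1 HA, K2K2i HA, K2iK2 HA, K1K2 HA, K1iK2, K1K2i, K1iK2i).
Let ke := (k1e1.1, k1e1.2, k1e2.1, k1e2.2, k2e1.1, k2e1.2, k2e2.1, k2e2.2).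
Let kf := (k1f1.1, k1f1.2, k1f2.1, k1f2.2, k2f1.1, k2f1.2, k2f2.1, k2f2.2).

Lemma E1F1_swap x : E1 (F1 x) = F1 (E1 x) + d^-1 *: (K1 x - K1i x).
Proof. by rewrite -(E1F1 HA) addrC subrK. Qed.
Lemma E2F2_swap x : E2 (F2 x) = F2 (E2 x) + d^-1 *: (K2 x - K2i x).
Proof. by rewrite -(E2F2 HA) addrC subrK. Qed.
Let ef := (E1F1_swap, E2F2_swap, E1F2 HA, E2F1 HA).

Lemma F112_swap x : F1 (F1 (F2 x)) = (q + q^-1) *: F1 (F2 (F1 x)) - F2 (F1 (F1 x)).
Proof.
apply/eqP; rewrite -subr_eq0 -[X in _ == X](SerreF12 HA x); apply/eqP.
lincomb C V; ring.
Qed.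
Lemma F122_swap x : F1 (F2 (F2 x)) = (q + q^-1) *: F2 (F1 (F2 x)) - F2 (F2 (F1 x)).
Proof.
apply/eqP; rewrite -subr_eq0 -[X in _ == X](SerreF21 HA x); apply/eqP.
lincomb C V; ring.
Qed.

Ltac lfield := field; rewrite -?expr2 ?q0 ?q21_neq0 //.
Ltac nf := rewrite ?(opD, opZ, opN, op0, kk, ke, kf, ef).

(* Locked, since otherwise rewriting with the linearity of an operator sees through to the
   scalar [(q - q^-1)^2]. *)
Definition Xop x := locked (d ^+ 2 *: C1op q A x).

Lemma XopE x : Xop x = d ^+ 2 *: F1 (E1 x) + q *: K1 x + q^-1 *: K1i x.
Proof.
rewrite /Xop -lock /C1op; have D := d_neq0; rewrite scalerDr scalerA divff ?expf_neq0 //.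
by rewrite scale1r addrA.
Qed.

Lemma Xop_lin : lin Xop.
Proof. move=> a x y; rewrite !XopE; nf; lincomb C V; ring. Qed.

(** C_1 is the Casimir element of the copy of U_q(sl_2) generated by E_1, F_1 and K_1. *)
Lemma Xop_E1 x : Xop (E1 x) = E1 (Xop x).
Proof.
rewrite !XopE; do 3 nf; lincomb C V; lfield.
Qed.

Lemma Xop_Kop x : Xop (Kop x) = Kop (Xop x).
Proof. rewrite /Defs.Kop !XopE; do 5 nf; lincomb C V; lfield. Qed.

Lemma Kop_F2 x : Kop (F2 x) = q ^- 3 *: F2 (Kop x).
Proof. rewrite /Defs.Kop; do 5 nf; lincomb C V; lfield. Qed.
Lemma Kop_K2 x : Kop (K2 x) = K2 (Kop x).
Proof. by rewrite /Defs.Kop !kk. Qed.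
Lemma Kop_lin : lin Kop.
Proof. by move=> a x y; rewrite /Defs.Kop !lins. Qed.

(** G is the defect of q-commutation between X and F_2. By [Xop_Gop], the pair F_2, G is closed
    under moving past X. *)
Definition Gop x := Xop (F2 x) - q *: F2 (Xop x).

Lemma Gop_lin : lin Gop.
Proof.
move=> t x y; rewrite /Gop !(opD, opZ, linopD Xop_lin, linopZ Xop_lin).
lincomb C V; ring.
Qed.

(** Links G to F_3 and F_2 K_1^-1, the terms from which u(n,0,1) is built. *)
Lemma GopE x : Gop x = d ^+ 2 *: F3 q A (E1 x) - (q^-1 * d) *: F2 (K1i x).
Proof. rewrite /Gop /F3 !XopE; do 4 nf; lincomb C V; lfield. Qed.

Lemma F3F2 x : F3 q A (F2 x) = q^-1 *: F2 (F3 q A x).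
Proof.
rewrite /F3; do 2 nf; rewrite F122_swap.
lincomb C V; lfield.
Qed.

Lemma Gop_F2 x : Gop (F2 x) = q^-1 *: F2 (Gop x).
Proof.
rewrite !GopE; do 2 nf; rewrite F3F2; do 2 nf; lincomb C V; lfield.
Qed.

Lemma Xop_Gop x : Xop (Gop x) = q^-1 *: Gop (Xop x) - d ^+ 2 *: F2 x.
Proof.
rewrite /Gop !XopE; do 6 nf; rewrite ?F112_swap; do 2 nf.
lincomb C V; lfield.
Qed.

(** * The generators acting on the vectors f(X) w_n *)

Section HighestVector.
Variables (alpha kappa c : C) (v : V).
Hypotheses (alpha0 : alpha != 0) (kappa0 : kappa != 0).
Hypothesis hv : highest_rel q A alpha kappa c v.

Local Notation X := Xop.
Local Notation chat := (d ^+ 2 * c).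
Definition wvec n : V := iter n F2 v.
Local Notation w := wvec.
Local Notation act := (pact Xop).
Let Xl := Xop_lin.
Let actl f := pact_lin Xop_lin f.

Lemma X_v : X v = chat *: v.
Proof. by case: hv => _ _ _ e; rewrite /Xop -lock e scalerA. Qed.

Lemma act_v f : act f v = f.[chat] *: v.
Proof. exact: (pact_eigen Xl _ X_v). Qed.

Lemma E1_act f n : E1 (act f (w n)) = alpha *: act f (w n).
Proof.
rewrite (pact_ind_commute _ _ (lin_E1 HA)) => [|y]; last by rewrite Xop_E1.
suff -> : E1 (w n) = alpha *: w n by rewrite (linopZ (actl _)).
elim: n => [|n IH]; first by case: hv.
by rewrite /wvec iterS (E1F2 HA) IH (linopZ (lin_F2 HA)).
Qed.

Lemma Kop_act f n : Kop (act f (w n)) = (kappa / q ^+ (3 * n)) *: act f (w n).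
Proof.
rewrite (pact_ind_commute _ _ Kop_lin) => [|y]; last by rewrite Xop_Kop.
suff -> : Kop (w n) = (kappa / q ^+ (3 * n)) *: w n by rewrite (linopZ (actl _)).
elim: n => [|n IH]; first by rewrite muln0 expr0 divr1; case: hv.
rewrite /wvec iterS Kop_F2 -/(w n) IH (linopZ (lin_F2 HA)) scalerA mulnS exprD.
by congr (_ *: _); field; rewrite !expf_neq0.
Qed.

Lemma q1_neq0 n : 1 - q ^- n.+1 ^+ 2 != 0.
Proof.
rewrite -exprVn -exprM exprVn subr_eq0 eq_sym invr_eq1 qroot // muln_gt0.
Qed.

(** Induction through G F_2 = q^-1 F_2 G: moving F_2 past X reproduces G w_{n+1} on the right, and
    the equation is solved for it. *)
Lemma Gop_w n : Gop (w n) = ((q ^+ 2 - 1) / (1 - q ^- n.+1 ^+ 2)) *: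
  (q ^- n.+1 ^+ 2 *: X (w n.+1) - (q ^- n.+1 * chat) *: w n.+1).
Proof.
have F2X y : F2 (X y) = q^-1 *: (X (F2 y) - Gop y).
  by rewrite /Gop opprB addrCA subrr addr0 scalerA mulVf ?scale1r.
have := q1_neq0 n; elim: n => [|n IH] un.
  rewrite -[w 0]/v /Gop X_v (linopZ (lin_F2 HA)) -[F2 v]/(w 1) expr1; have := un; rewrite expr1 => un'.
  have e : 1 - q^-1 ^+ 2 = (q ^+ 2 - 1) / q ^+ 2 by field.
  rewrite e; lincomb C V; lfield.
have u0 : q ^- n.+1 != 0 by rewrite invr_neq0 ?expf_neq0.
have := IH (q1_neq0 n); have := q1_neq0 n; have eS : q ^- n.+2 = q ^- n.+1 / q.
  by rewrite exprSr invfM.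
rewrite eS in un *; move: (q ^- n.+1) un u0 => u un u0 un1 G1.
have := Gop_F2 (w n); rewrite -[F2 (w n)]/(w n.+1) G1.
rewrite !(opD, opZ, opN) F2X -[F2 (w n.+1)]/(w n.+2) => e.
(* The total coefficient of G w_{n+1} is (1 - q^(-2n-4)) / (1 - q^(-2n-2)), nonzero because q is not
   a root of unity. *)
have nz : 1 + (q ^+ 2 - 1) / (1 - u ^+ 2) * u ^+ 2 / q ^+ 2 != 0.
  have -> : 1 + (q ^+ 2 - 1) / (1 - u ^+ 2) * u ^+ 2 / q ^+ 2 = (1 - (u / q) ^+ 2) / (1 - u ^+ 2).
    field; by rewrite q0 un1.
  by rewrite mulf_neq0 ?invr_neq0.
apply: (scalerI nz).
have -> : (1 + (q ^+ 2 - 1) / (1 - u ^+ 2) * u ^+ 2 / q ^+ 2) *: Gop (w n.+1) =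
  Gop (w n.+1) + ((q ^+ 2 - 1) / (1 - u ^+ 2) * u ^+ 2 / q ^+ 2) *: Gop (w n.+1).
  by rewrite scalerDl scale1r.
rewrite [X in X + _]e.
have un' : q * q - u * u != 0.
  have -> : q * q - u * u = (1 - (u / q) ^+ 2) * q ^+ 2 by field.
  by rewrite mulf_neq0 ?expf_neq0.
have un1' : 1 - u * u != 0 by rewrite -expr2.
by lincomb C V; field; rewrite ?un' ?un1' ?q0.
Qed.

(** Multiplying f by x changes the pair (a, b) by a two by two matrix over C[x]. At x = z + 1/z the
    row (z, -(1 - q^2)^-1) is a left eigenvector of it with eigenvalue [inv_sum (z / q)], so this
    combination sees f only through its value there. *)
Lemma F2_act f n : exists a b,
  [/\ F2 (act f (w n)) = act a (w n.+1), Gop (act f (w n)) = act b (w n.+1) &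
   forall z : C, z != 0 -> z * a.[inv_sum z] - (1 - q ^+ 2)^-1 * b.[inv_sum z] =
     (1 - q ^- n.+1 ^+ 2)^-1 * (z - q ^- n.+1 * chat + q ^- n.+1 ^+ 2 / z) * f.[inv_sum (z / q)]].
Proof.
have F2X y : F2 (X y) = q^-1 *: (X (F2 y) - Gop y).
  by rewrite /Gop opprB addrCA subrr addr0 scalerA mulVf ?scale1r.
have GX y : Gop (X y) = q *: (X (Gop y) + d ^+ 2 *: F2 y).
  by rewrite Xop_Gop subrK scalerA divff ?scale1r.
have Gl := Gop_lin.
have qq1 := q21_neq0; have un := q1_neq0 n.
elim/poly_ind: f => [|f t [a [b [Fa Gb H]]]].
  exists 0, 0; rewrite !pact0; split; rewrite ?(linop0 Gl) ?(linop0 (lin_F2 HA)) //.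
  by move=> z _; rewrite !horner0 !mulr0 subrr.
exists (q^-1 *: (a * 'X - b) + t%:P),
  (q *: (b * 'X + d ^+ 2 *: a) +
   (t * ((q ^+ 2 - 1) / (1 - q ^- n.+1 ^+ 2))) *: (q ^- n.+1 ^+ 2 *: 'X - (q ^- n.+1 * chat)%:P)).
split.
- rewrite !(pactD, pactZ, pactN, pactMX Xl, pactC) (linopD (lin_F2 HA)) F2X Fa Gb.
  by rewrite (linopZ (lin_F2 HA)).
- rewrite !(pactD, pactZ, pactN, pactMX Xl, pactC, pactX Xl) (linopD Gl) GX Fa Gb.
  by rewrite (linopZ Gl) Gop_w scalerA.
move=> z zn0; rewrite hornerMXaddC !(hornerD, hornerN, hornerZ, hornerMX, hornerC, hornerX).
rewrite [RHS]mulrDr [X in _ = X + _]mulrA -H //.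
move: un; move: (q ^- n.+1) (a.[_]) (b.[_]) => u a' b' un.
have n1 : 1 - q * q != 0 by rewrite -expr2 -opprB oppr_eq0.
have n1' : 1 - q ^+ 2 != 0 by rewrite expr2.
by rewrite /inv_sum; field; rewrite -?expr2 ?un ?zn0 ?q0 ?n1' ?qq1.
Qed.
Lemma K1_eigen (k : C) x : Kop x = k *: x -> K1 x = k *: K2i (K2i x).
Proof. by move=> e; rewrite -!opZ -e /Defs.Kop !kk. Qed.

Lemma K1i_eigen (k : C) x : k != 0 -> Kop x = k *: x -> K1i x = k^-1 *: K2 (K2 x).
Proof.
move=> k0 e; apply: (scalerI k0); rewrite scalerA divff // scale1r -opZ -e /Defs.Kop.
by rewrite !kk.
Qed.

(** The definition of X solved for F_1: closure under F_1 will follow from closure under X and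
    powers of K_2. *)
Lemma F1_eigen (k : C) x : k != 0 -> E1 x = alpha *: x -> Kop x = k *: x ->
  F1 x = (alpha * d ^+ 2)^-1 *:
    (X x - (q * k) *: K2i (K2i x) - (q^-1 * k^-1) *: K2 (K2 x)).
Proof.
move=> k0 e1 ek; have D : alpha * d ^+ 2 != 0 by rewrite mulf_neq0 ?expf_neq0 ?d_neq0.
apply: (scalerI D); rewrite scalerA divff // scale1r XopE e1 opZ (K1_eigen ek).
by rewrite (K1i_eigen k0 ek); lincomb C V; ring.
Qed.

Lemma E2_Xop (k : C) x b b' : k != 0 -> E1 x = alpha *: x ->
  E1 b = alpha *: b -> E1 b' = alpha *: b' -> Kop b = k *: b -> Kop b' = k *: b' ->
  E2 x = K2 b + K2i b' ->
  E2 (X x) = K2 (q^-1 *: X b + ((q ^- 2 - 1) / k) *: b') +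
             K2i (q *: X b' + ((q ^+ 2 - 1) * k) *: b).
Proof.
move=> k0 e1 eb eb' kb kb' e2.
have E2K1 y : E2 (K1 y) = q *: K1 (E2 y) by rewrite !ke scalerA divff ?scale1r.
have E2K1i y : E2 (K1i y) = q^-1 *: K1i (E2 y) by rewrite !ke scalerA divff ?invr_eq0 ?scale1r.
have qi : q^-1^-1 = q by rewrite invrK.
rewrite !XopE eb eb' e1 !(opD, opZ, E2F1 HA, E2K1, E2K1i) e2 !(opD, opZ).
have F1K2 y : F1 (K2 y) = q^-1 *: K2 (F1 y) by rewrite !kf scalerA mulVf ?scale1r.
have F1K2i y : F1 (K2i y) = q *: K2i (F1 y) by rewrite !kf scalerA divff ?scale1r.
rewrite F1K2 F1K2i !(F1_eigen k0) // !(K1_eigen kb, K1_eigen kb', K1i_eigen k0 kb, K1i_eigen k0 kb').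
rewrite !XopE eb eb' !(opD, opZ, opN, kk) !(K1_eigen kb, K1_eigen kb', K1i_eigen k0 kb, K1i_eigen k0 kb').
rewrite !(opD, opZ, opN, kk).
have D := d_neq0; lincomb C V; lfield; rewrite ?alpha0 ?k0 //.
Qed.

Definition qn n : C := (q ^+ n.+1 - q ^- n.+1) / d ^+ 2.

Lemma qn_neq0 n : qn n != 0.
Proof.
rewrite /qn mulf_neq0 ?invr_eq0 ?expf_neq0 ?d_neq0 //.
have e : q ^+ n.+1 - q ^- n.+1 = (q ^+ (n.+1 * 2) - 1) / q ^+ n.+1.
  by rewrite exprM; field; rewrite expf_neq0.
rewrite e mulf_neq0 ?invr_eq0 ?expf_neq0 // subr_eq0 qroot // muln_gt0.
Qed.

Lemma E2_w n : E2 (w n.+1) = qn n *: (q ^+ n *: K2 (w n) - q ^- n *: K2i (w n)).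
Proof.
elim: n => [|n IH].
  rewrite /wvec iterS E2F2_swap; case: hv => _ -> _ _; rewrite op0 add0r /qn !expr1.
  lincomb C V; lfield.
rewrite -[w n.+2]/(F2 (w n.+1)) E2F2_swap IH !(opZ, opD, opN).
have F2K2 y : F2 (K2 y) = q ^+ 2 *: K2 (F2 y) by rewrite !kf scalerA divff ?scale1r.
have F2K2i y : F2 (K2i y) = q ^- 2 *: K2i (F2 y) by rewrite !kf scalerA divff ?scale1r.
rewrite F2K2 F2K2i -[F2 (w n)]/(w n.+1) /qn !exprS.
have qn0 : q ^+ n != 0 by rewrite expf_neq0.
lincomb C V; lfield; by rewrite ?qn0.
Qed.

(** The device of [F2_act] again: by [E2_Xop], multiplying f by x changes (a, b) by a matrix with
    left eigenvector (q k z, 1), k = kappa / q^(3n), and eigenvalue [inv_sum (z / q)]. *)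
Lemma E2_act f n : exists a b,
  E2 (act f (w n.+1)) = K2 (act a (w n)) + K2i (act b (w n)) /\
  forall z : C, z != 0 -> b.[inv_sum z] + q * (kappa / q ^+ (3 * n)) * z * a.[inv_sum z] =
    qn n * q ^+ n * q * (kappa / q ^+ (3 * n)) * (z - q ^+ n / (q * kappa)) * f.[inv_sum (z / q)].
Proof.
have qn0 m : q ^+ m != 0 by rewrite expf_neq0.
have k0 : kappa / q ^+ (3 * n) != 0 by rewrite mulf_neq0 ?invr_eq0.
elim/poly_ind: f => [|f t [a [b [Ea H]]]].
  exists 0, 0; rewrite !pact0 !op0 addr0; split=> // z _.
  by rewrite !horner0 !mulr0 addr0.
exists (q^-1 *: (a * 'X) + ((q ^- 2 - 1) / (kappa / q ^+ (3 * n))) *: b + (t * qn n * q ^+ n)%:P),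
   (q *: (b * 'X) + ((q ^+ 2 - 1) * (kappa / q ^+ (3 * n))) *: a - (t * qn n / q ^+ n)%:P).
split.
  rewrite !(pactD, pactZ, pactN, pactMX Xl, pactC) opD.
  rewrite (@E2_Xop (kappa / q ^+ (3 * n)) _ (act a (w n)) (act b (w n))) ?E1_act ?Kop_act //.
  rewrite opZ E2_w !(opD, opZ, opN); lincomb C V; ring.
move=> z zn0; rewrite hornerMXaddC !(hornerD, hornerN, hornerZ, hornerMX, hornerC).
rewrite [RHS]mulrDr [X in _ = X + _]mulrA -H //.
have e3 : q ^+ (3 * n) = (q ^+ n) ^+ 3 by rewrite mulnC exprM.
rewrite e3; move: (q ^+ n) (qn0 n) (a.[_]) (b.[_]) (qn n) => u u0 a' b' r.
rewrite /inv_sum; field; by rewrite u0 zn0 q0 kappa0.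
Qed.

Definition Kz (l : int) (x : V) : V :=
  match l with Posz n => iter n K2 x | Negz n => iter n.+1 K2i x end.

Lemma Kz_K2 l x : K2 (Kz l x) = Kz (l + 1) x.
Proof.
case: l => [n|[|n]]; first by rewrite -PoszD addn1.
  by rewrite /= (K2K2i HA).
have -> : Negz n.+1 + 1 = Negz n by rewrite !NegzE intS; ring.
by rewrite /Kz iterS (K2K2i HA).
Qed.

Lemma Kz_K2i l x : K2i (Kz l x) = Kz (l - 1) x.
Proof.
case: l => [[|n]|n]; first by [].
  have -> : n.+1%:Z - 1 = n by rewrite intS; ring.
  by rewrite /Kz iterS (K2iK2 HA).
by have -> : Negz n - 1 = Negz n.+1 by rewrite !NegzE [n.+2%:Z]intS; ring.
Qed.

Lemma Kz_lin l : lin (Kz l).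
Proof. by case: l => n; [apply: iter_lin (lin_K2 HA) _ | apply: iter_lin (lin_K2i HA) _]. Qed.

Lemma Kz_comm (T : V -> V) t : lin T -> t != 0 -> (forall x, T (K2 x) = t *: K2 (T x)) ->
  forall l x, T (Kz l x) = t ^ l *: Kz l (T x).
Proof.
move=> Tl t0 H; have H' x : T (K2i x) = t^-1 *: K2i (T x).
  apply: (scalerI t0); rewrite scalerA divff // scale1r -[in RHS](K2K2i HA x) H opZ.
  by rewrite (K2iK2 HA).
case=> n x; elim: n => [|n IH].
- by rewrite expr0z scale1r.
- by rewrite /Kz !iterS H -/(Kz n x) IH opZ scalerA -!exprnP -exprS.
- by rewrite /= H' NegzE -exprnN expr1.
- rewrite /Kz iterS H' -/(Kz (Negz n) x) IH opZ scalerA !NegzE -!exprnN.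
  by rewrite -[Kz _ _]/(iter n.+1 K2i (T x)) -iterS -invfM -exprS.
Qed.

Lemma Kz_cancel l x : Kz (- l) (Kz l x) = x.
Proof.
case: l => [[|n]|n] //.
- have -> : - n.+1%:Z = Negz n by rewrite NegzE.
  by rewrite /Kz; elim: n => [|n IH] /=; [rewrite (K2iK2 HA) | rewrite -iterS iterSr /= (K2iK2 HA)].
- have -> : - Negz n = n.+1%:Z by rewrite NegzE opprK.
  by rewrite /Kz; elim: n => [|n IH] /=; [rewrite (K2K2i HA) | rewrite -iterS iterSr /= (K2K2i HA)].
Qed.

Lemma E1_Kz l x : E1 (Kz l x) = q ^ l *: Kz l (E1 x).
Proof.
by apply: (Kz_comm (lin_E1 HA) q0) => y; rewrite !ke scalerA divff ?scale1r.
Qed.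
Lemma E2_Kz l x : E2 (Kz l x) = (q ^- 2) ^ l *: Kz l (E2 x).
Proof.
by apply: (Kz_comm (lin_E2 HA) qqi0) => y; rewrite !ke scalerA mulVf ?scale1r.
Qed.
Lemma F1_Kz l x : F1 (Kz l x) = q^-1 ^ l *: Kz l (F1 x).
Proof.
by apply: (Kz_comm (lin_F1 HA) qi0) => y; rewrite !kf scalerA mulVf ?scale1r.
Qed.
Lemma F2_Kz l x : F2 (Kz l x) = (q ^+ 2) ^ l *: Kz l (F2 x).
Proof.
by apply: (Kz_comm (lin_F2 HA) qq0) => y; rewrite !kf scalerA divff ?scale1r.
Qed.
Lemma Kop_Kz l x : Kop (Kz l x) = Kz l (Kop x).
Proof.
by rewrite (Kz_comm Kop_lin (oner_neq0 C)) ?exp1rz ?scale1r // => y; rewrite scale1r Kop_K2.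
Qed.

Section Submodule.
Variable S : V -> Prop.
Hypothesis HS : submod A S.
Lemma sub0 : S 0. Proof. by case: HS. Qed.
Lemma subD x y : S x -> S y -> S (x + y). Proof. by case: HS => _ H _ _ _; apply: H. Qed.
Lemma subZ t x : S x -> S (t *: x). Proof. by case: HS => _ _ H _ _; apply: H. Qed.
Lemma subN x : S x -> S (- x). Proof. by rewrite -scaleN1r; apply: subZ. Qed.
Lemma subB x y : S x -> S y -> S (x - y). Proof. by move=> ? /subN; apply: subD. Qed.
Lemma subZr t x : t != 0 -> S (t *: x) -> S x.
Proof. by move=> t0 /(subZ t^-1); rewrite scalerA mulVf ?scale1r. Qed.
Lemma subE1 x : S x -> S (E1 x). Proof. by case: HS => _ _ _ H _ /H[]. Qed.
Lemma subE2 x : S x -> S (E2 x). Proof. by case: HS => _ _ _ H _ /H[]. Qed.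
Lemma subF1 x : S x -> S (F1 x). Proof. by case: HS => _ _ _ H _ /H[]. Qed.
Lemma subF2 x : S x -> S (F2 x). Proof. by case: HS => _ _ _ H _ /H[]. Qed.
Lemma subK1 x : S x -> S (K1 x). Proof. by case: HS => _ _ _ _ H /H[]. Qed.
Lemma subK1i x : S x -> S (K1i x). Proof. by case: HS => _ _ _ _ H /H[]. Qed.
Lemma subK2 x : S x -> S (K2 x). Proof. by case: HS => _ _ _ _ H /H[]. Qed.
Lemma subK2i x : S x -> S (K2i x). Proof. by case: HS => _ _ _ _ H /H[]. Qed.
Lemma subKop x : S x -> S (Kop x). Proof. by move=> ?; apply/subK1/subK2/subK2. Qed.
Lemma subX x : S x -> S (X x).
Proof.
by move=> Sx; rewrite XopE; apply/subD/subZ/subK1i => //; apply: subD; apply: subZ;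
  [apply/subF1/subE1 | apply: subK1].
Qed.
Lemma sub_act f x : S x -> S (act f x).
Proof.
move=> Sx; elim/poly_ind: f => [|f t IH]; first by rewrite pact0; apply: sub0.
by rewrite pactD pactMX // pactC; apply: subD; [apply: subX | apply: subZ].
Qed.
Lemma subKz l x : S x -> S (Kz l x).
Proof.
by move=> Sx; case: l => n; elim: n => [|n IH] //=;
  [apply: subK2 | apply: subK2i | apply: subK2i].
Qed.
Lemma subKzr l x : S (Kz l x) -> S x.
Proof. by move/(subKz (- l)); rewrite Kz_cancel. Qed.
End Submodule.

Lemma submod0 : submod A (fun x => x = 0).
Proof.
split=> //; first by move=> x y -> ->; rewrite addr0.
- by move=> a x ->; rewrite scaler0.
- by move=> x ->; rewrite !op0.
- by move=> x ->; rewrite !op0.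
Qed.

Lemma gen_submod x : submod A (gen A x).
Proof.
split=> [T /sub0 //|y z Hy Hz T HT Tx|t y Hy T HT Tx|y Hy|y Hy].
- by apply: subD => //; [apply: Hy | apply: Hz].
- by apply: subZ => //; apply: Hy.
- by split=> T HT Tx; have Ty := Hy T HT Tx; case: HT => _ _ _ /(_ y Ty)[].
- by split=> T HT Tx; have Ty := Hy T HT Tx; case: HT => _ _ _ _ /(_ y Ty)[].
Qed.

Lemma gen_id x : gen A x x.
Proof. by []. Qed.

(** * Weight decomposition of submodules *)

Local Notation term := (nat * int * {poly C})%type.
Definition tm (t : term) : V := Kz t.1.2 (act t.2 (w t.1.1)).

Definition wspan (Q : nat -> {poly C} -> Prop) (x : V) : Prop :=
  exists2 s : seq term, (forall t, t \in s -> Q t.1.1 t.2) & x = \sum_(t <- s) tm t.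

Lemma tmZ a n l f : tm (n, l, a *: f) = a *: tm (n, l, f).
Proof. by rewrite /tm pactZ (linopZ (Kz_lin l)). Qed.
Lemma tmD n l f g : tm (n, l, f + g) = tm (n, l, f) + tm (n, l, g).
Proof. by rewrite /tm pactD (linopD (Kz_lin l)). Qed.

Section Span.
Variable Q : nat -> {poly C} -> Prop.
Hypothesis QM : forall n f g, Q n f -> Q n (g * f).

Lemma wspan0 : wspan Q 0.
Proof. by exists [::] => //; rewrite big_nil. Qed.
Lemma wspanD x y : wspan Q x -> wspan Q y -> wspan Q (x + y).
Proof.
case=> s Qs -> [s' Qs' ->]; exists (s ++ s'); last by rewrite big_cat.
by move=> t; rewrite mem_cat => /orP[/Qs|/Qs'].
Qed.
Lemma wspan_tm n l f : Q n f -> wspan Q (tm (n, l, f)).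
Proof. by exists [:: (n, l, f)]; rewrite ?big_seq1 // => t; rewrite inE => /eqP->. Qed.

Lemma wspan_closed (T : V -> V) : lin T ->
  (forall n l f, Q n f -> wspan Q (T (tm (n, l, f)))) -> forall x, wspan Q x -> wspan Q (T x).
Proof.
move=> Tl H x [s Qs ->]; elim: s Qs => [|[[n l] f] s IH] Qs.
  by rewrite big_nil (linop0 Tl); apply: wspan0.
rewrite big_cons (linopD Tl); apply: wspanD; first by apply/H/(Qs (n, l, f)); rewrite mem_head.
by apply: IH => t ts; apply: Qs; rewrite inE ts orbT.
Qed.

Lemma wspanZ a x : wspan Q x -> wspan Q (a *: x).
Proof.
apply: (wspan_closed (T := fun x => a *: x)) => [b y z|n l f Qf].
  by rewrite scalerDr !scalerA mulrC.
by rewrite -tmZ; apply: wspan_tm; rewrite -mul_polyC; apply: QM.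
Qed.
Lemma wspanK2 x : wspan Q x -> wspan Q (K2 x).
Proof.
apply: (wspan_closed (lin_K2 HA)) => n l f Qf.
by rewrite /tm Kz_K2 -[Kz _ _]/(tm (n, l + 1, f)); apply: wspan_tm.
Qed.
Lemma wspanK2i x : wspan Q x -> wspan Q (K2i x).
Proof.
apply: (wspan_closed (lin_K2i HA)) => n l f Qf.
by rewrite /tm Kz_K2i -[Kz _ _]/(tm (n, l - 1, f)); apply: wspan_tm.
Qed.
Lemma wspanKz l x : wspan Q x -> wspan Q (Kz l x).
Proof.
by move=> Sx; case: l => n; elim: n => [|n IH] //=;
  [apply: wspanK2 | apply: wspanK2i | apply: wspanK2i].
Qed.
Lemma wspan_act n f : Q n f -> wspan Q (act f (w n)).
Proof. exact: (@wspan_tm n 0 f). Qed.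

Hypothesis QF : forall n f, Q n f -> wspan Q (F2 (act f (w n))).
Hypothesis QE : forall n f, Q n f -> wspan Q (E2 (act f (w n))).

(** On each term E_1 and K act by scalars, so K_1 acts as a multiple of K_2^-2, and [F1_eigen]
    expresses F_1. Only F_2 and E_2 remain to be controlled. *)
Lemma wspan_submod : submod A (wspan Q).
Proof.
have kn n : kappa / q ^+ (3 * n) != 0 by rewrite mulf_neq0 ?invr_eq0 ?expf_neq0.
have E1c : forall x, wspan Q x -> wspan Q (E1 x).
  apply: (wspan_closed (lin_E1 HA)) => n l f Qf.
  by rewrite /tm E1_Kz E1_act (linopZ (Kz_lin l)); do 2 apply: wspanZ; apply: wspan_tm.
have E2c : forall x, wspan Q x -> wspan Q (E2 x).
  apply: (wspan_closed (lin_E2 HA)) => n l f Qf.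
  by rewrite /tm E2_Kz; apply/wspanZ/wspanKz/QE.
have F2c : forall x, wspan Q x -> wspan Q (F2 x).
  apply: (wspan_closed (lin_F2 HA)) => n l f Qf.
  by rewrite /tm F2_Kz; apply/wspanZ/wspanKz/QF.
have F1c : forall x, wspan Q x -> wspan Q (F1 x).
  apply: (wspan_closed (lin_F1 HA)) => n l f Qf.
  rewrite /tm F1_Kz; apply/wspanZ/wspanKz.
  rewrite (F1_eigen (kn n)) ?E1_act ?Kop_act //; apply: wspanZ.
  rewrite -!scaleNr; apply: wspanD; first apply: wspanD.
  - by rewrite -pactMX // mulrC; apply/wspan_act/QM.
  - by apply/wspanZ/wspanK2i/wspanK2i/wspan_act.
  - by apply/wspanZ/wspanK2/wspanK2/wspan_act.
have K1c : forall x, wspan Q x -> wspan Q (K1 x).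
  apply: (wspan_closed (lin_K1 HA)) => n l f Qf.
  rewrite (@K1_eigen (kappa / q ^+ (3 * n))); last first.
    by rewrite /tm Kop_Kz Kop_act (linopZ (Kz_lin l)).
  by apply/wspanZ/wspanK2i/wspanK2i/wspan_tm.
have K1ic : forall x, wspan Q x -> wspan Q (K1i x).
  apply: (wspan_closed (lin_K1i HA)) => n l f Qf.
  rewrite (K1i_eigen (kn n)); last by rewrite /tm Kop_Kz Kop_act (linopZ (Kz_lin l)).
  by apply/wspanZ/wspanK2/wspanK2/wspan_tm.
split.
- exact: wspan0.
- exact: wspanD.
- exact: wspanZ.
- by move=> x Qx; split; auto.
- by move=> x Qx; split; auto using wspanK2, wspanK2i.
Qed.
End Span.

Lemma q_inj (a b : int) : q ^ a = q ^ b -> a = b.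
Proof.
have K (k : int) : q ^ k = 1 -> k = 0.
  case: k => [[|n]|n] //; first by rewrite -exprnP => /eqP; rewrite (negPf (qroot _)).
  by rewrite NegzE -exprnN => /eqP; rewrite invr_eq1 (negPf (qroot _)).
move=> e; apply/eqP; rewrite -subr_eq0; apply/eqP/K.
by rewrite expfzDr // e -expfzDr // subrr expr0z.
Qed.

Definition Kweight (n : nat) : C := kappa / q ^+ (3 * n).

Lemma Kweight_inj n m : Kweight n = Kweight m -> n = m.
Proof.
move=> /(mulfI kappa0)/invr_inj; rewrite !exprnP => /q_inj[] /eqP.
by rewrite eqn_mul2l => /eqP.
Qed.

Lemma Kop_tm t : Kop (tm t) = Kweight t.1.1 *: tm t.
Proof. by rewrite /tm Kop_Kz Kop_act (linopZ (Kz_lin _)). Qed.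

Lemma E1_tm t : E1 (tm t) = (alpha * q ^ t.1.2) *: tm t.
Proof. by rewrite /tm E1_Kz E1_act (linopZ (Kz_lin _)) scalerA mulrC. Qed.

(* The weights [(n, l)] are separated by the eigenvalues of [K] and [E1]. *)
Lemma tm_separate (S : V -> Prop) n l f (s : seq term) : submod A S ->
  (forall t, t \in s -> t.1 != (n, l)) ->
  S (tm (n, l, f) + \sum_(t <- s) tm t) -> S (tm (n, l, f)).
Proof.
move=> HS; move: {2}(size s) (erefl (size s)) => N.
elim: N s f => [|N IH] [|[[n2 l2] f2] s] f //=.
  by move=> _ _; rewrite big_nil addr0.
case=> sN H; rewrite big_cons addrA => Sx.
(* T - mu (n2, l2) kills the head of the list and rescales the other terms, the one of weight (n, l)
   by a nonzero scalar, so the induction on the length applies. *)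
have step (T : V -> V) (mu : nat * int -> C) : lin T -> (forall x, S x -> S (T x)) ->
    (forall t, T (tm t) = mu t.1 *: tm t) -> mu (n, l) != mu (n2, l2) -> S (tm (n, l, f)).
  move=> Tl ST Tmu ne; rewrite -subr_eq0 in ne; apply: (subZr HS ne); rewrite -tmZ.
  apply: (IH [seq (t.1, (mu t.1 - mu (n2, l2)) *: t.2) | t <- s]).
  - by rewrite size_map.
  - by move=> t' /mapP[t ts ->]; apply: (H t); rewrite inE ts orbT.
  have := subB HS (ST _ Sx) (subZ HS (mu (n2, l2)) Sx).
  rewrite !(linopD Tl) (linop_sum Tl) !Tmu !scalerDr !opprD /= big_map tmZ.
  congr S; rewrite addrACA [X in X + _ = _]addrACA subrr addr0 scalerBl; congr (_ + _).
  rewrite scaler_sumr -sumrB; apply: eq_bigr => -[[n' l'] f'] _.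
  by rewrite Tmu tmZ scalerBl.
have : (n2, l2) != (n, l) by apply: (H (n2, l2, f2)); rewrite mem_head.
rewrite xpair_eqE negb_and => /orP[nn|ll].
  apply: (step Kop (fun t => Kweight t.1) Kop_lin) => [x|t|]; [exact: subKop|exact: Kop_tm|].
  by apply: contra nn => /= /eqP/Kweight_inj->.
apply: (step E1 (fun t => alpha * q ^ t.2) (lin_E1 HA)) => [x|t|]; [exact: subE1|exact: E1_tm|].
by apply: contra ll => /= /eqP/(mulfI alpha0)/q_inj->.
Qed.

Lemma sum_tm_split n l (s : seq term) :
  \sum_(t <- s) tm t =
  tm (n, l, \sum_(t <- s | t.1 == (n, l)) t.2) + \sum_(t <- [seq t <- s | t.1 != (n, l)]) tm t.
Proof.
rewrite big_filter [LHS](bigID (fun t : term => t.1 == (n, l))) /=; congr (_ + _).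
elim/big_rec2: _ => [|[[n' l'] f] y y' /= /eqP[-> ->] ->]; first by rewrite /tm pact0 (linop0 (Kz_lin l)).
by rewrite tmD.
Qed.

(** [tm_separate] puts the weight components of an element of S in S. They are split off one at a
    time, and K_2^l is removed because it is invertible. *)
Lemma submod_compare (S T : V -> Prop) : submod A S -> submod A T ->
  (forall n f, S (act f (w n)) -> T (act f (w n))) ->
  forall x, wspan (fun _ _ => True) x -> S x -> T x.
Proof.
move=> HS HT ST x [s _ ->]; move: {2}(size s).+1 (ltnSn (size s)) => N.
elim: N s => // N IH [|[[n l] f] s]; first by rewrite big_nil => _ _; apply: sub0.
rewrite ltnS /= => sN; rewrite (sum_tm_split n l) => Sx.
have ne t : t \in [seq t <- (n, l, f) :: s | t.1 != (n, l)] -> t.1 != (n, l).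
  by rewrite mem_filter => /andP[].
have S1 := tm_separate HS ne Sx.
have T1 := subKz HT l (ST _ _ (subKzr HS S1)).
apply: (subD HT T1); apply: IH; last by have := subB HS Sx S1; rewrite addrAC subrr add0r.
by rewrite /= eqxx (leq_ltn_trans _ sN) // size_filter count_size.
Qed.

(** The sum of the weight spaces is direct, by [tm_separate] for the zero submodule, so only the
    terms of weight (n, 0) contribute. *)
Lemma wspan_homogeneous (Q : nat -> {poly C} -> Prop) n f :
  Q n 0 -> (forall f g, Q n f -> Q n g -> Q n (f + g)) ->
  wspan Q (act f (w n)) -> exists2 g, Q n g & act f (w n) = act g (w n).
Proof.
move=> Q0 QD [s Qs]; rewrite (sum_tm_split n 0); set g := \sum_(t <- s | _) _ => e.
exists g.
  rewrite /g big_seq_cond; apply: big_ind => // -[[n' l'] f'] /andP[/Qs /= Qt /eqP[<- _]].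
  by [].
pose s' : seq term := [seq (t.1, - t.2) | t <- s & t.1 != (n, 0)].
have z : tm (n, 0, f - g) + \sum_(t <- s') tm t = 0.
  rewrite /tm /= pactD pactN e -/(tm (n, 0, g)) /s' big_map [X in X - _]addrC addrK.
  rewrite -big_split big1 // => -[[n' l'] f'] _ /=.
  by rewrite /tm /= pactN (linopN (Kz_lin _)) subrr.
have := @tm_separate _ n 0 (f - g) s' submod0; rewrite z => H.
have : tm (n, 0, f - g) = 0.
  by apply: H => // t' /mapP[t]; rewrite mem_filter => /andP[? _] ->.
by rewrite /tm /= pactD pactN => /eqP; rewrite subr_eq0 => /eqP.
Qed.

Lemma wspanT_submod : submod A (wspan (fun _ _ => True)).
Proof.
apply: wspan_submod => // [n f _|[|n] f _].
- by have [a [b [-> _ _]]] := F2_act f n; apply: wspan_act.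
- rewrite -[w 0]/v act_v opZ; case: hv => _ -> _ _; rewrite scaler0.
  exact: wspan0.
- have [a [b [-> _]]] := E2_act f n.
  by apply: wspanD; [apply/wspanK2/wspan_act | apply/wspanK2i/wspan_act].
Qed.

Lemma gen_wspan x : gen A v x -> wspan (fun _ _ => True) x.
Proof.
move=> /(_ _ wspanT_submod); apply.
by have := @wspan_act (fun _ _ => True) 0 1 I; rewrite pact1.
Qed.

Lemma sub_climb S f n : submod A S -> S (act f (w n)) -> exists a b,
  [/\ S (act a (w n.+1)), S (act b (w n.+1)) &
   forall z : C, z != 0 -> z * a.[inv_sum z] - (1 - q ^+ 2)^-1 * b.[inv_sum z] =
     (1 - q ^- n.+1 ^+ 2)^-1 * (z - q ^- n.+1 * chat + q ^- n.+1 ^+ 2 / z) * f.[inv_sum (z / q)]].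
Proof.
move=> HS Sf; have [a [b [Ea Eb H]]] := F2_act f n; exists a, b; split=> //.
  by rewrite -Ea; apply: subF2.
by rewrite -Eb /Gop; apply: (subB HS); [apply/(subX HS)/(subF2 HS) | apply/(subZ HS)/(subF2 HS)/(subX HS)].
Qed.

(** The two components of E_2 f(X) w_{n+1} are eigenvectors of E_1 with distinct eigenvalues alpha q
    and alpha q^-1, so each of them lies in S. *)
Lemma sub_descend S f n : submod A S -> S (act f (w n.+1)) -> exists a b,
  [/\ S (act a (w n)), S (act b (w n)) &
  forall z : C, z != 0 -> b.[inv_sum z] + q * Kweight n * z * a.[inv_sum z] =
    qn n * q ^+ n * q * Kweight n * (z - q ^+ n / (q * kappa)) * f.[inv_sum (z / q)]].
Proof.
move=> HS Sf; have [a [b [E H]]] := E2_act f n; exists a, b.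
have S1 := subE2 HS Sf; have S2 := subE1 HS S1; rewrite E in S1 S2.
have ad : alpha * d != 0 by rewrite mulf_neq0 ?d_neq0.
have E1K2 y : E1 (K2 y) = q *: K2 (E1 y) by rewrite !ke scalerA divff ?scale1r.
have E1K2i y : E1 (K2i y) = q^-1 *: K2i (E1 y).
  by rewrite !ke invrK scalerA mulVf ?scale1r.
rewrite opD E1K2 E1K2i !E1_act !opZ in S2; split=> //.
- apply: (subZr HS ad); rewrite -(K2iK2 HA (act a _)) -opZ; apply: subK2i => //.
  have := subB HS S2 (subZ HS (alpha * q^-1) S1); congr S; lincomb C V; ring.
- apply: (subZr HS ad); rewrite -(K2K2i HA (act b _)) -opZ; apply: subK2 => //.
  have := subB HS (subZ HS (alpha * q) S1) S2; congr S; lincomb C V; ring.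
Qed.

(** * Submodules compared with the partial products, degree by degree *)

Section Rungs.
Variable y0 : C.
Hypotheses (y00 : y0 != 0) (hy : chat = inv_sum y0).
Local Notation R := (rung q y0).

Lemma qexpN n : q ^ (- n%:Z - 1) = q ^- n.+1.
Proof. by rewrite -opprD addrC -intS -exprnN. Qed.

(** P_n(X) w_n = 0 implies G P_n(X) w_n = 0. In [rung_climb] with n + 1 factors one has s t = 1, so
    b is a nonzero multiple of P_{n+1}. *)
Lemma act_full_rung n : act (R n.+1 n) (w n) = 0.
Proof.
elim: n => [|n IH].
  rewrite /rung big_ord1 subr0 mulr0 expr0z mulr1 pactD pactN pactX // pactC.
  by rewrite -hy -[w 0]/v X_v subrr.
have [a [b [_ Sb H]]] := sub_climb submod0 IH.
have n1 : 1 - q ^+ 2 != 0 by rewrite -opprB oppr_eq0 q21_neq0.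
have [|_ /= e] := @rung_climb C q y0 q0 y00 n.+1 n (1 - q ^- n.+1 ^+ 2)^-1 a b.
  by move=> z z0; rewrite H // hy qexpN.
have e1 : 2 * n.+1%:Z - n%:Z - 1 = n.+1%:Z :> int by rewrite intS; ring.
have e2 : n%:Z + 1 = n.+1%:Z :> int by rewrite intS addrC.
have e3 : y0 * q ^ n.+1%:Z * (q ^ (- n%:Z - 1) / y0) = 1.
  by rewrite qexpN -exprnP; field; rewrite y00 expf_neq0.
have e4 : q ^ (- n%:Z - 1) / y0 = (y0 * q ^ n.+1%:Z)^-1.
  by rewrite qexpN -exprnP invfM mulrC.
rewrite e1 e2 e3 e4 scale1r -/(inv_sum _) in e.
rewrite rungS; have -> : 2 * n.+1%:Z - n.+1%:Z = n.+1%:Z :> int by ring.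
set K := _ / _ in e; have K0 : K != 0.
  by rewrite /K mulf_neq0 ?invr_eq0 ?expf_neq0 ?q1_neq0.
apply: (scalerI K0); rewrite scaler0 -pactZ mulrC -[X in act X _]opprK -scalerN -mulNr opprB.
by rewrite -e pactN pactZ Sb scaler0 oppr0.
Qed.

(** Here s t = q^(-2(n+1-m)) is not 1, so F_2 yields a nonzero multiple of [rung m (n + 1)] by
    [rung_climb]. *)
Lemma rung_up_sub S m n : submod A S -> (m <= n)%N -> S (act (R m n) (w n)) ->
  S (act (R m n.+1) (w n.+1)).
Proof.
move=> HS mn Sf; have [a [b [Sa _ H]]] := sub_climb HS Sf.
have [|/= ea _] := @rung_climb C q y0 q0 y00 m n (1 - q ^- n.+1 ^+ 2)^-1 a b.
  by move=> z z0; rewrite H // hy qexpN.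
move: Sa; have e2 : n%:Z + 1 = n.+1%:Z :> int by rewrite intS addrC.
rewrite ea e2 pactZ; apply: subZr => //.
rewrite !mulf_neq0 ?invr_eq0 ?expf_neq0 ?q1_neq0 //.
have -> : y0 * q ^ (2 * m%:Z - n%:Z - 1) * (q ^ (- n%:Z - 1) / y0) = q ^ (- (2 * (n.+1 - m))%N%:Z).
  have -> : - (2 * (n.+1 - m))%N%:Z = (2 * m%:Z - n%:Z - 1) + (- n%:Z - 1) :> int.
    by rewrite PoszM -subzn 1?ltnW // intS; ring.
  rewrite [RHS]expfzDr //; move: (q ^ (2 * m%:Z - n%:Z - 1)) (q ^ (- n%:Z - 1)) => u u'.
  by field.
rewrite -exprnN subr_eq0 eq_sym invr_eq1 qroot // muln_gt0 /= subn_gt0 ltnS //.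
Qed.

Lemma rung_gen S m n : submod A S -> (m <= n)%N -> S (act (R m m) (w m)) ->
  S (act (R m n) (w n)).
Proof.
move=> HS; elim: n => [|n IH]; first by rewrite leqn0 => /eqP->.
rewrite leq_eqVlt => /orP[/eqP-> //|mn Sm].
by apply: rung_up_sub => //; apply: IH.
Qed.

(** The condition on y0 makes the zero q^n / (q kappa) of [E2_act] equal to q^(n+2-2m) / y0, the one
    required by [rung_descend] in degree n + 1. This is the upper bound matching the lower bound
    [rung_gen]. *)
Lemma rung_dvd_descend S m n : submod A S -> y0 = q ^ (3 - 2 * m%:Z) * kappa ->
  (forall f, S (act f (w n)) -> R m n %| f) ->
  forall f, S (act f (w n.+1)) -> R m n.+1 %| f.
Proof.
move=> HS yE H f /(sub_descend HS)[a [b [/H/dvdpP[a' ea] /H/dvdpP[b' eb] E]]].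
have k0 : Kweight n != 0 by rewrite mulf_neq0 ?invr_eq0 ?expf_neq0.
apply: (@rung_descend C q y0 q0 y00 m n.+1 (qn n * q ^+ n * q * Kweight n)
  (q ^+ n / (q * kappa)) f b' ((q * Kweight n) *: a')).
- by rewrite mulf_neq0 ?k0 // mulf_neq0 // mulf_neq0 ?qn_neq0 ?expf_neq0.
- have -> : n.+1%:Z + 1 - 2 * m%:Z = n%:Z - 1 + (3 - 2 * m%:Z) :> int by rewrite intS; ring.
  rewrite (expfzDr (n%:Z - 1)) // yE; have := expfz_neq0 (3 - 2 * m%:Z) q0.
  move: (q ^ (3 - _)) => t t0; rewrite expfzDr // -invr_expz expr1z -exprnP.
  by field; rewrite q0 t0 kappa0.
move=> z z0; rewrite -E // ea eb !(hornerM, hornerZ).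
have -> : n.+1%:Z - 1 = n%:Z :> int by rewrite intS; ring.
ring.
Qed.

(** By the same coincidence of zeros, [rung_down] makes both coordinates multiples of P_m, and
    P_m(X) kills w_m. *)
Lemma rung_singular m : y0 = q ^ (3 - 2 * m.+1%:Z) * kappa ->
  E2 (act (R m.+1 m.+1) (w m.+1)) = 0.
Proof.
move=> yE; have [a [b [-> H]]] := E2_act (R m.+1 m.+1) m.
have k0 : Kweight m != 0 by rewrite mulf_neq0 ?invr_eq0 ?expf_neq0.
pose N := qn m * q ^+ m * q * Kweight m / q ^+ m.+1.
have [z z0 _|-> ea] := @comp_uniq C [::] b ((q * Kweight m) *: a)
    ((- (N * (q ^ (m.+1%:Z + 1) / y0))) *: R m.+1 m) (N *: R m.+1 m).
  rewrite hornerZ mulrA [z * _]mulrC H // -/(Kweight m).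
  have e : q ^+ m / (q * kappa) = q ^ (m.+1%:Z + 1 - 2 * m.+1%:Z) / y0.
    have -> : m.+1%:Z + 1 - 2 * m.+1%:Z = m%:Z - 1 + (3 - 2 * m.+1%:Z) :> int by rewrite intS; ring.
    rewrite (expfzDr (m%:Z - 1)) // yE; have := expfz_neq0 (3 - 2 * m.+1%:Z) q0.
    move: (q ^ (3 - _)) => t t0; rewrite expfzDr // -invr_expz expr1z -exprnP.
    by field; rewrite q0 t0 kappa0.
  have := rung_down q0 y00 m.+1 m.+1 z0; rewrite -e.
  have -> : m.+1%:Z - 1 = m%:Z :> int by rewrite intS; ring.
  move=> E; rewrite -mulrA [X in _ * X]mulrC E !hornerZ /N; ring.
have -> : a = (q * Kweight m)^-1 *: (N *: R m.+1 m).
  by rewrite -ea scalerA mulVf ?scale1r // mulf_neq0.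
by rewrite !pactZ act_full_rung !scaler0 !op0 addr0.
Qed.

Lemma rung_eigen m : X (act (R m m) (w m)) = inv_sum (y0 * q ^+ m) *: act (R m m) (w m).
Proof.
have := act_full_rung m; rewrite rungS; have -> : 2 * m%:Z - m%:Z = m%:Z :> int by ring.
rewrite mulrBr pactD pactN pactMX // mulrC mul_polyC pactZ -exprnP.
by move/eqP; rewrite subr_eq0 => /eqP.
Qed.

(** Obtained from the PBW model in [act_wvec_inj]. With [act_full_rung] it makes P_n the minimal
    polynomial of X on w_n. *)
Hypothesis ind : forall n (f : {poly C}), (size f <= n.+1)%N -> act f (w n) = 0 -> f = 0.

Lemma act_eq0 n f : act f (w n) = 0 -> R n.+1 n %| f.
Proof.
have mP := rung_monic q y0 n.+1 n; rewrite {1}(divp_eq f (R n.+1 n)) pactD pactM // act_full_rung.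
rewrite (linop0 (actl _)) add0r => /ind e; apply/modp_eq0P/e.
by rewrite -ltnS -(size_rung q y0 n.+1 n) ltn_modp monic_neq0.
Qed.

Lemma act_rung_neq0 m : act (R m m) (w m) <> 0.
Proof.
move/ind; rewrite size_rung leqnn => /(_ isT)/eqP.
by rewrite -size_poly_eq0 size_rung.
Qed.

Lemma first_nontrivial_dvd S f n : submod A S ->
  (forall f, S (act f (w n)) -> act f (w n) = 0) -> S (act f (w n.+1)) ->
  let eps := q ^+ n / (q * kappa) / q in let Q := q ^+ n.+1 in
  R n.+2 n.+1 %| f * ('X - (eps + Q * inv_sum y0 - eps * Q ^+ 2)%:P) /\
  R n.+2 n.+1 %| ((Q ^+ 2 - 1) * (1 + eps ^+ 2 * Q ^+ 2 - eps * Q * inv_sum y0)) *: f.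
Proof.
move=> HS triv /(sub_descend HS)[a [b [/triv/act_eq0/dvdpP[a' ea] /triv/act_eq0/dvdpP[b' eb] E]]].
have k0 : Kweight n != 0 by rewrite mulf_neq0 ?invr_eq0 ?expf_neq0.
apply: (@rung_first C q y0 q0 y00 n.+1 (qn n * q ^+ n * q * Kweight n)
  (q ^+ n / (q * kappa)) f b' ((q * Kweight n) *: a')).
- by rewrite mulf_neq0 ?k0 // mulf_neq0 // mulf_neq0 ?qn_neq0 ?expf_neq0.
- by rewrite !(mulf_neq0, invr_eq0, expf_neq0).
move=> z z0; rewrite -E // ea eb !(hornerM, hornerZ).
have -> : n.+1%:Z - 1 = n%:Z :> int by rewrite intS; ring.
ring.
Qed.
End Rungs.

(** * Singular vectors and the submodules they generate *)

Section Structure.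
Hypothesis ind : forall n (f : {poly C}), (size f <= n.+1)%N -> act f (w n) = 0 -> f = 0.

(** The point y0 for which h_m(kappa, c) = y0 + 1/y0 - (q - q^-1)^2 c; for critical m it is the
    parameter required by [rung_dvd_descend]. *)
Definition sing_param (m : nat) : C := q ^ (3 - 2 * m%:Z) * kappa.
Definition sing_vec (m : nat) : V := act (rung q (sing_param m) m m) (w m).

Lemma sing_param_neq0 m : sing_param m != 0.
Proof. by rewrite mulf_neq0 ?expfz_neq0. Qed.

Lemma sing_param_inj m n : sing_param m = sing_param n -> m = n.
Proof.
move=> /(mulIf kappa0)/q_inj/addrI/oppr_inj/(mulfI (isT : 2%:Z != 0)).
by case.
Qed.

Lemma hnE m : hn q kappa c m = inv_sum (sing_param m) - chat.
Proof.
rewrite /hn /inv_sum /sing_param invfM; congr (_ + _ * _ - _); rewrite invr_expz.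
by congr (q ^ _); ring.
Qed.

Lemma hn_chat m : hn q kappa c m = 0 -> chat = inv_sum (sing_param m).
Proof. by rewrite hnE => /eqP; rewrite subr_eq0 => /eqP. Qed.

Lemma hn_two m n : hn q kappa c m = 0 -> hn q kappa c n = 0 -> m <> n -> sing_param m * sing_param n = 1.
Proof.
move=> /hn_chat em /hn_chat en mn; have := inv_sum_eq (sing_param_neq0 m) (sing_param_neq0 n).
rewrite -em -en eqxx => /esym/orP[/eqP/sing_param_inj //|/eqP//].
Qed.

Lemma sing_vec_neq0 m : sing_vec m <> 0.
Proof. exact: act_rung_neq0. Qed.

(** By [first_nontrivial_dvd], P_{n+1} divides a scalar multiple of f but not f, so the scalar is
    zero, which is criticality. The other divisibility then shows that f is a multiple of the
    product defining [sing_vec n.+1]. *)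
Lemma first_degree (S : V -> Prop) f n : submod A S ->
  (forall f, S (act f (w n)) -> act f (w n) = 0) ->
  S (act f (w n.+1)) -> act f (w n.+1) <> 0 -> hn q kappa c n.+1 = 0 /\ S (sing_vec n.+1).
Proof.
move=> HS triv Sf nz; pose eps := q ^+ n / (q * kappa) / q; pose Q := q ^+ n.+1.
have eps0 : eps != 0 by rewrite /eps !(mulf_neq0, invr_eq0, expf_neq0).
have Q0 : Q != 0 by rewrite expf_neq0.
have eQ : eps * Q = (sing_param n.+1)^-1.
  rewrite /eps /Q /sing_param; have -> : 3 - 2 * n.+1%:Z = - (n%:Z - 1 + n%:Z) :> int by rewrite intS; ring.
  rewrite -invr_expz !expfzDr // -invr_expz expr1z -exprnP exprS.
  by field; rewrite q0 kappa0 expf_neq0.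
have K1 (e u z : C) : e != 0 -> u != 0 ->
    1 + e ^+ 2 * u ^+ 2 - e * u * inv_sum z = e * u * (inv_sum (e * u) - inv_sum z).
  by move=> e0 u0; move: (inv_sum z) => r; rewrite /inv_sum; field; rewrite e0 u0.
have K2 (e u : C) : e != 0 -> u != 0 -> e + u * inv_sum (e * u) - e * u ^+ 2 = inv_sum e.
  by move=> e0 u0; rewrite /inv_sum; field; rewrite e0 u0.
have h0 : hn q kappa c n.+1 = 0.
  (* Criticality is not yet known, so any y0 giving the right eigenvalue of X on v is taken. *)
  have [y0 y00 ey] := inv_sum_surj chat.
  have [_] := first_nontrivial_dvd y00 (esym ey) ind HS triv Sf; rewrite -/eps -/Q.
  apply: contraTeq => h; apply/negP; rewrite dvdpZr; last first.
    rewrite mulf_neq0 //; first by rewrite /Q -exprM subr_eq0 qroot // muln_gt0.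
    rewrite K1 //.
    apply: mulf_neq0; first exact: mulf_neq0.
    by rewrite eQ inv_sum_inv ey -hnE.
  move/dvdpP => [g fE]; apply: nz.
  by rewrite fE pactM // (act_full_rung y00 (esym ey)) (linop0 (actl _)).
split=> //; have ec := hn_chat h0; have yn := sing_param_neq0 n.+1.
have [] := first_nontrivial_dvd yn ec ind HS triv Sf; rewrite -/eps -/Q.
have -> : eps + Q * inv_sum (sing_param n.+1) - eps * Q ^+ 2 = inv_sum eps.
  by rewrite -[sing_param _]invrK -eQ inv_sum_inv K2.
(* The linear factor multiplying f is the last factor of P_{n+1}, so it cancels. *)
have e1 : inv_sum (sing_param n.+1 * q ^ (2 * n.+1%:Z - n.+1%:Z)) = inv_sum eps.
  have -> : 2 * n.+1%:Z - n.+1%:Z = n.+1%:Z :> int by ring.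
  by rewrite -exprnP -/Q -[sing_param _]invrK -eQ -[in RHS](inv_sum_inv eps) invfM mulfVK.
rewrite rungS e1 dvdp_mul2r ?polyXsubC_eq0 // => /dvdpP[g fE] _.
have XR h : act (h * ('X - (inv_sum eps)%:P)) (sing_vec n.+1) = 0.
  have := act_full_rung yn ec n.+1; rewrite rungS e1 /sing_vec mulrC pactM // pactM // => ->.
  by rewrite (linop0 (actl _)).
(* The singular vector is an eigenvector of X for [inv_sum eps], so g(X) acts on it by
   [g.[inv_sum eps]], nonzero because f(X) w_{n+1} is. *)
have /factor_theorem[h gE] : root (g - g.[inv_sum eps]%:P) (inv_sum eps).
  by rewrite /root !hornerE subrr.
have ge : g = h * ('X - (inv_sum eps)%:P) + g.[inv_sum eps]%:P by rewrite -gE subrK.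
move: nz Sf; rewrite fE pactM // -/(sing_vec n.+1) ge pactD XR add0r pactC => nz.
apply: subZr => //; apply/eqP => e; apply: nz; by rewrite e scale0r.
Qed.

(** In degree n > m both submodules are compared with [rung m.+1 n] at the critical parameter: it
    divides every f with f(X) w_n in S, and its vector lies in the generated submodule by
    [rung_gen]. *)
Lemma submod_contained (S : V -> Prop) m : submod A S -> hn q kappa c m.+1 = 0 ->
  (forall y, gen A v y) ->
  (forall k f, (k <= m)%N -> S (act f (w k)) -> act f (w k) = 0) ->
  forall x, S x -> gen A (sing_vec m.+1) x.
Proof.
move=> HS h0 cyc triv x; have yn := sing_param_neq0 m.+1; have ec := hn_chat h0.
apply: (submod_compare HS (gen_submod _)); last exact: gen_wspan.
move=> n f Sf; have [nm|mn] := leqP n m.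
  by rewrite (triv n f nm Sf); apply: (sub0 (gen_submod _)).
suff /dvdpP[g ->] : rung q (sing_param m.+1) m.+1 n %| f.
  rewrite pactM //; apply: (sub_act (gen_submod (sing_vec m.+1))).
  by apply: (rung_gen (S := gen A (sing_vec m.+1)) yn ec (gen_submod _)).
elim: n mn f Sf => // n IH; rewrite ltnS leq_eqVlt => /orP[/eqP<-|mn] f Sf.
  (* The induction starts from degree m, where [rung m.+1 m] is all of P_m and S is zero. *)
  apply: (rung_dvd_descend (S := S) yn HS _ _ Sf) => // g Sg.
  by apply: (act_eq0 yn ec ind); exact: (triv _ _ (leqnn m) Sg).
apply: (rung_dvd_descend (S := S) yn HS _ _ Sf) => // g Sg; exact: IH.
Qed.

(** The two critical parameters are inverse to each other, so by [rung_rev] they give the same P_m,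
    in two orders of its factors. *)
Lemma sing_vec_chain m n : (n < m)%N -> hn q kappa c m = 0 -> hn q kappa c n = 0 ->
  gen A (sing_vec n) (sing_vec m).
Proof.
move=> nm hm hn'.
have mn : m <> n by move=> e; move: nm; rewrite e ltnn.
have e1 := hn_two hm hn' mn.
have yn := sing_param_neq0 n; have ec := hn_chat hn'.
suff /dvdpP[g gE] : rung q (sing_param n) n m %| rung q (sing_param m) m m.
  rewrite /sing_vec gE pactM //; apply: (sub_act (gen_submod (sing_vec n))).
  by apply: (rung_gen (S := gen A (sing_vec n)) yn ec (gen_submod _)) => //; apply: ltnW.
(* F is the factor of index n of P_m at [sing_param n], and the last factor, of index m, at
   [sing_param m]. *)
pose F : {poly C} := 'X - (inv_sum (sing_param n * q ^ (2 * n%:Z - m%:Z)))%:P.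
rewrite -(@dvdp_mul2r _ F) ?polyXsubC_eq0 // -rungS.
have -> : rung q (sing_param m) m m * F = rung q (sing_param m) m.+1 m.
  rewrite rungS; congr (_ * ('X - (inv_sum _)%:P)); rewrite /sing_param ![_ * kappa * _]mulrAC -!expfzDr //.
  by congr (q ^ _ * _); ring.
have -> : sing_param m = (sing_param n)^-1 by rewrite -(mulfK yn (sing_param m)) e1 mul1r.
by rewrite rung_rev; apply: rung_dvd; apply: ltnW.
Qed.

(** The singular vector satisfies the defining relations for new parameters, so [gen_wspan]
    describes the submodule it generates. *)
Lemma sing_vec_highest m : hn q kappa c m.+1 = 0 ->
  highest_rel q A alpha (Kweight m.+1) (inv_sum (sing_param m.+1 * q ^+ m.+1) / d ^+ 2) (sing_vec m.+1).
Proof.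
move=> h; have yn := sing_param_neq0 m.+1; have ec := hn_chat h; split.
- exact: E1_act.
- exact: (rung_singular yn ec).
- exact: Kop_act.
- have D2 : d ^+ 2 != 0 by rewrite expf_neq0 ?d_neq0.
  apply: (scalerI D2); rewrite scalerA mulrCA divff // mulr1.
  by have := rung_eigen yn ec m.+1; rewrite /Xop -lock.
Qed.
End Structure.

(** * Identification of u(m,0,1) with the singular vector *)

Section SingularVector.
Variable m : nat.
Hypothesis hm : hn q kappa c m = 0.
Local Notation s_ n := (q ^ (1 - n%:Z) / sing_param m).

(* [u(m,0,1)] is a product of first-order operators, by the q-binomial theorem. *)
Fixpoint thvec (n : nat) : V :=
  if n is n'.+1 then
    F2 (thvec n') - (s_ n' * (1 - q ^+ 2)^-1) *: Gop (thvec n')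
  else v.

(** By [rung_theta], each operator contributes the next factor of the product. *)
Lemma thvec_rung n : exists2 t, t != 0 & thvec n = t *: act (rung q (sing_param m) n n) (w n).
Proof.
have yn := sing_param_neq0 m; have ec := hn_chat hm.
elim: n => [|n [t t0 IH]].
  by exists 1; rewrite ?oner_eq0 // /rung big_ord0 pact1 scale1r.
have [a [b [Fa Gb H]]] := F2_act (rung q (sing_param m) n n) n.
have e2 : n%:Z + 1 = n.+1%:Z :> int by rewrite intS addrC.
rewrite ec -qexpN in H.
have := @rung_theta C q (sing_param m) q0 yn n (1 - (q ^ (- n%:Z - 1)) ^+ 2)^-1 a b H.
rewrite e2 qexpN; set t' := (X in _ = X *: _) => E.
have t'0 : t' != 0.
  by rewrite /t' !(mulf_neq0, invr_eq0, expf_neq0, q1_neq0, expfz_neq0).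
exists (t * t'); first by rewrite mulf_neq0.
have Gl := Gop_lin.
rewrite -scalerA -(pactZ _ t') -E pactD pactN !pactZ.
rewrite -[thvec _]/(F2 (thvec n) - (s_ n * (1 - q ^+ 2)^-1) *: Gop (thvec n)) IH opZ (linopZ Gl) Fa Gb.
lincomb C V; ring.
Qed.

Lemma thvec_E1 n : E1 (thvec n) = alpha *: thvec n.
Proof. by have [t _ ->] := thvec_rung n; rewrite opZ E1_act !scalerA mulrC. Qed.

Definition dvec (n k j : nat) : V := iter (n - k) F2 (iter k (F3 q A) (iter (2 * j) K2 v)).

Lemma F3_lin : lin (F3 q A).
Proof. move=> t x y; rewrite /F3 !lins; lincomb C V; ring. Qed.

Lemma iter_comm (T U : V -> V) (t : C) n x : lin U -> (forall x, T (U x) = t *: U (T x)) ->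
  T (iter n U x) = t ^+ n *: iter n U (T x).
Proof.
move=> Ul H; elim: n => [|n IH]; first by rewrite scale1r.
by rewrite !iterS H IH (linopZ Ul) scalerA -exprS.
Qed.

Lemma K1i_v : K1i v = kappa^-1 *: K2 (K2 v).
Proof. by apply: K1i_eigen => //; case: hv. Qed.

(** F_3 and K_1^-1 q-commute with the powers to their right, and K_1^-1 v = kappa^-1 K_2^2 v
    accounts for the step in j. *)
Lemma dvec_step n k j : (k <= n)%N ->
  [/\ F2 (dvec n k j) = dvec n.+1 k j,
      F3 q A (dvec n k j) = q^-1 ^+ (n - k) *: dvec n.+1 k.+1 j &
      F2 (K1i (dvec n k j)) = (q^-1 ^+ (n - k) * q ^+ k / kappa) *: dvec n.+1 k j.+1].
Proof.
move=> kn; split.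
- by rewrite /dvec subSn.
- by rewrite /dvec (iter_comm _ _ (lin_F2 HA) F3F2).
rewrite /dvec (iter_comm _ _ (lin_F2 HA) (t := q^-1)); last by move=> x; rewrite kf.
have K1iF3 x : K1i (F3 q A x) = q *: F3 q A (K1i x).
  by rewrite /F3; do 2 nf; lincomb C V; lfield.
rewrite (iter_comm _ _ F3_lin K1iF3) (iter_comm _ _ (lin_K2 HA) (t := 1)); last first.
  by move=> x; rewrite kk scale1r.
rewrite expr1n scale1r K1i_v (linopZ (iter_lin (lin_K2 HA) _)) -!iterSr.
rewrite (linopZ (iter_lin F3_lin _)) !(linopZ (iter_lin (lin_F2 HA) _)) !scalerA !opZ.
by rewrite mulrA subSn // mulnS.
Qed.

Lemma qnum_neq0 n : qnum q n.+1 != 0.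
Proof.
rewrite /qnum mulf_neq0 ?invr_eq0 ?d_neq0 //.
have -> : q ^+ n.+1 - q ^- n.+1 = (q ^+ (2 * n.+1) - 1) / q ^+ n.+1.
  by rewrite mulnC exprM; field; rewrite expf_neq0.
by rewrite mulf_neq0 ?invr_eq0 ?expf_neq0 // subr_eq0 qroot // muln_gt0.
Qed.

Lemma qfactS n : qfact q n.+1 = qnum q n.+1 * qfact q n.
Proof. by rewrite /qfact big_nat_recr //= mulrC. Qed.

Lemma qfact_neq0 n : qfact q n != 0.
Proof.
elim: n => [|n IH]; first by rewrite /qfact big_nil oner_eq0.
by rewrite qfactS mulf_neq0 ?qnum_neq0.
Qed.

Definition qtri (n k j : nat) : C :=
  if (k + j <= n)%N then qfact q n / (qfact q k * qfact q j * qfact q (n - k - j)) else 0.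

Lemma qtri_binom n k j : (k <= n)%N -> qbinom q n k * qbinom q (n - k) j = qtri n k j.
Proof.
move=> kn; rewrite /qbinom /qtri kn leq_subRL //; case: leqP => _; last by rewrite mulr0.
by field; rewrite !qfact_neq0.
Qed.

Lemma qtri_n n k j : (k + j <= n.+1)%N ->
  qnum q n.+1 * qtri n k j = qnum q (n.+1 - k - j) * qtri n.+1 k j.
Proof.
move=> h; rewrite /qtri h; move: h; rewrite leq_eqVlt => /orP[/eqP e|h].
  by rewrite e ltnn mulr0 -subnDA e subnn /qnum expr0 invr1 subrr !mul0r.
have h' : (k + j <= n)%N by [].
rewrite h' -!subnDA subSn // !qfactS.
by field; rewrite !qfact_neq0 qnum_neq0.
Qed.

Lemma qtri_k n k j : qnum q n.+1 * qtri n k j = qnum q k.+1 * qtri n.+1 k.+1 j.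
Proof.
rewrite /qtri addSn ltnS; case: ifP => _; last by rewrite !mulr0.
by rewrite subSS !qfactS; field; rewrite !qfact_neq0 !qnum_neq0.
Qed.

Lemma qtri_j n k j : qnum q n.+1 * qtri n k j = qnum q j.+1 * qtri n.+1 k j.+1.
Proof.
rewrite /qtri addnS ltnS; case: ifP => h; last by rewrite !mulr0.
rewrite -!subnDA addnS subSS !qfactS.
by field; rewrite !qfact_neq0 !qnum_neq0.
Qed.

(* For [n = m] this is [acoef] times the scalar by which [Kinv ^ (2 j + k)] acts on [v]. *)
Definition tcoef (n k j : nat) : C :=
  (-1) ^+ j * (alpha / kappa * (q ^+ 2 - 1)) ^+ k / kappa ^+ (2 * j)
  * (q ^+ (2 * m) / q ^+ n) ^+ (k + j) * q ^+ (k * j) * q ^+ 'C(k, 2) / q ^+ (3 * (k + j))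
  * qtri n k j.

(** [ck] and [cj] are the scalars with which the n-th operator of [thvec] raises k, through F_3, and
    j, through F_2 K_1^-1. *)
Definition ck (n k : nat) : C :=
  q ^+ (2 * m) / kappa * alpha * (q ^+ 2 - 1) * q ^+ k / (q ^+ 4 * q ^+ (2 * n)).
Definition cj (n k : nat) : C :=
  - (q ^+ (2 * m) / kappa ^+ 2 * q ^+ (2 * k) / (q ^+ 4 * q ^+ (2 * n))).

(** Pascal's rule for q-trinomial coefficients: multiplied by [n + 1], the three terms become
    multiples of [qtri n.+1 k j] with factors [n+1-k-j], [k] and [j], whose sum with suitable powers
    of q is [n + 1]. *)
Lemma tcoef_rec n k j :
  tcoef n.+1 k j = tcoef n k j + (if k is k'.+1 then ck n k' * tcoef n k' j else 0)
                   + (if j is j'.+1 then cj n k * tcoef n k j' else 0).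
Proof.
have [h|h] := leqP (k + j) n.+1; last first.
  have z a b : (n < a + b)%N -> tcoef n a b = 0.
    by move=> ab; rewrite /tcoef /qtri leqNgt ab mulr0.
  rewrite z; last exact: ltnW.
  have -> : tcoef n.+1 k j = 0 by rewrite /tcoef /qtri leqNgt h mulr0.
  by case: k j h => [|k] [|j] h; rewrite ?z ?mulr0 ?addr0 //; move: h; rewrite ?addSn ?addnS.
apply: (mulfI (qnum_neq0 n)).
pose g N k j := (-1) ^+ j * (alpha / kappa * (q ^+ 2 - 1)) ^+ k / kappa ^+ (2 * j)
  * (q ^+ (2 * m) / q ^+ N) ^+ (k + j) * q ^+ (k * j) * q ^+ 'C(k, 2) / q ^+ (3 * (k + j)).
have tE N a b : tcoef N a b = g N a b * qtri N a b by [].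
have T1 : qnum q n.+1 * tcoef n k j = g n k j * (qnum q (n.+1 - k - j) * qtri n.+1 k j).
  by rewrite -qtri_n // tE mulrCA.
have T2 : qnum q n.+1 * (if k is k'.+1 then ck n k' * tcoef n k' j else 0) =
    (if k is k'.+1 then ck n k' * g n k' j else 0) * (qnum q k * qtri n.+1 k j).
  case: k {h T1} => [|k]; first by rewrite mulr0 mul0r.
  by rewrite -qtri_k tE; ring.
have T3 : qnum q n.+1 * (if j is j'.+1 then cj n k * tcoef n k j' else 0) =
    (if j is j'.+1 then cj n k * g n k j' else 0) * (qnum q j * qtri n.+1 k j).
  case: j {h T1 T2} => [|j]; first by rewrite mulr0 mul0r.
  by rewrite -qtri_j tE; ring.
have q00 : qnum q 0 = 0 by rewrite /qnum expr0 invr1 subrr mul0r.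
have qz N : q ^+ N != 0 by rewrite expf_neq0.
have pn : q ^+ (2 * m) / q ^+ n = q ^+ (2 * m) / q ^+ n.+1 * q.
  by rewrite exprS; field; rewrite q0 qz.
have qn2 : q ^+ (2 * n) = q ^+ n ^+ 2 by rewrite mulnC exprM.
have G1 : g n k j = g n.+1 k j * q ^+ (k + j) by rewrite /g pn [(_ * q) ^+ _]exprMn; ring.
have G2 : (if k is k'.+1 then ck n k' * g n k' j else 0) * qnum q k =
    g n.+1 k j * (q ^+ k / q ^+ n.+1) * qnum q k.
  case: k {h T1 T2 T3 G1} => [|k]; first by rewrite q00 !mulr0.
  have e1 : (alpha / kappa * (q ^+ 2 - 1)) ^+ k.+1 =
      alpha / kappa * (q ^+ 2 - 1) * (alpha / kappa * (q ^+ 2 - 1)) ^+ k by rewrite exprS.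
  have e2 : (q ^+ (2 * m) / q ^+ n.+1) ^+ (k.+1 + j) =
      q ^+ (2 * m) / q ^+ n.+1 * (q ^+ (2 * m) / q ^+ n.+1) ^+ (k + j) by rewrite addSn exprS.
  have e3 : q ^+ (k.+1 * j) = q ^+ j * q ^+ (k * j) by rewrite mulSn exprD.
  have e4 : q ^+ 'C(k.+1, 2) = q ^+ 'C(k, 2) * q ^+ k by rewrite binS bin1 exprD.
  have e5 : q ^+ (3 * (k.+1 + j)) = q ^+ 3 * q ^+ (3 * (k + j)) by rewrite addSn mulnS exprD.
  congr (_ * _); rewrite /g /ck pn qn2 e1 e2 e3 e4 e5 [(_ * q) ^+ _]exprMn.
  rewrite [q ^+ (k + j)]exprD [q ^+ k.+1]exprS.
  move: ((q ^+ (2 * m) / q ^+ n.+1) ^+ (k + j)) => P; rewrite [q ^+ n.+1]exprS.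
  move: (q ^+ (3 * (k + j))) (qz (3 * (k + j))%N) (q ^+ 'C(k, 2)) (q ^+ (k * j)) => x1 x10 x2 x3.
  move: (kappa ^+ (2 * j)) (expf_neq0 (2 * j) kappa0) ((-1) ^+ j) (_ ^+ k) => x4 x40 x5.
  move: (q ^+ (2 * m)) (q ^+ n) (qz n) (q ^+ k) (q ^+ j) => S Q Q0 K J B.
  by field; rewrite q0 Q0 x10 x40 kappa0.
have G3 : (if j is j'.+1 then cj n k * g n k j' else 0) * qnum q j =
    g n.+1 k j * (q ^+ (2 * k + j) / q ^+ n.+1) * qnum q j.
  case: j {h T1 T2 T3 G1 G2} => [|j]; first by rewrite q00 !mulr0.
  have e1 : (-1 : C) ^+ j.+1 = - (-1) ^+ j by rewrite exprS mulN1r.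
  have e2 : (q ^+ (2 * m) / q ^+ n.+1) ^+ (k + j.+1) =
      q ^+ (2 * m) / q ^+ n.+1 * (q ^+ (2 * m) / q ^+ n.+1) ^+ (k + j) by rewrite addnS exprS.
  have e3 : q ^+ (k * j.+1) = q ^+ k * q ^+ (k * j) by rewrite mulnS exprD.
  have e4 : kappa ^+ (2 * j.+1) = kappa ^+ 2 * kappa ^+ (2 * j) by rewrite mulnS exprD.
  have e5 : q ^+ (3 * (k + j.+1)) = q ^+ 3 * q ^+ (3 * (k + j)) by rewrite addnS mulnS exprD.
  have e6 : q ^+ (2 * k + j.+1) = q ^+ k ^+ 2 * (q * q ^+ j).
    by rewrite exprD mulnC exprM [q ^+ j.+1]exprS.
  have e7 : q ^+ (2 * k) = q ^+ k ^+ 2 by rewrite mulnC exprM.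
  congr (_ * _); rewrite /g /cj pn qn2 e1 e2 e3 e4 e5 e6 e7 [(_ * q) ^+ _]exprMn [q ^+ (k + j)]exprD.
  move: ((q ^+ (2 * m) / q ^+ n.+1) ^+ (k + j)) => P; rewrite [q ^+ n.+1]exprS.
  move: (q ^+ (3 * (k + j))) (qz (3 * (k + j))%N) (q ^+ 'C(k, 2)) (q ^+ (k * j)) => x1 x10 x2 x3.
  move: (kappa ^+ (2 * j)) (expf_neq0 (2 * j) kappa0) ((-1) ^+ j) ((_ * _) ^+ k) => x4 x40 x5 B.
  move: (q ^+ (2 * m)) (q ^+ n) (qz n) (q ^+ k) (q ^+ j) => S Q Q0 K J.
  by field; rewrite q0 Q0 x10 x40 kappa0.
have E : qnum q n.+1 = q ^+ (k + j) * qnum q (n.+1 - k - j) + q ^+ k / q ^+ n.+1 * qnum q k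
    + q ^+ (2 * k + j) / q ^+ n.+1 * qnum q j.
  have eN : q ^+ (n.+1 - (k + j)) = q ^+ n.+1 / (q ^+ k * q ^+ j).
    by apply: (mulIf (qz (k + j)%N)); rewrite [X in _ = _ * X]exprD mulfVK ?mulf_neq0 // -exprD subnK.
  have e7 : q ^+ (2 * k) = q ^+ k ^+ 2 by rewrite mulnC exprM.
  rewrite /qnum -subnDA eN [q ^+ (k + j)]exprD [q ^+ (2 * k + j)]exprD e7; have := d_neq0.
  move: (q ^+ n.+1) (qz n.+1) (q ^+ k) (qz k) (q ^+ j) (qz j) => a a0 b b0 e e0 D.
  by field; rewrite a0 b0 e0 q0 -expr2 q21_neq0.
rewrite !mulrDr T1 T2 T3 tE [X in _ = _ + X + _]mulrA [X in _ = _ + X]mulrA G2 G3 G1.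
rewrite [in LHS]E; move: (g _ _ _) (qtri _ _ _) => *; ring.
Qed.

Lemma sum_shift (W : nmodType) N (G : nat -> W) : G 0 = 0 -> G N = 0 ->
  \sum_(k < N) G k.+1 = \sum_(k < N) G k.
Proof.
move=> G0 GN; have <- : \sum_(k < N.+1) G k = \sum_(k < N) G k.+1.
  by rewrite big_ord_recl G0 add0r; apply: eq_bigr.
by rewrite big_ord_recr /= GN addr0.
Qed.

(** Summing over a fixed square of side N > n keeps the ranges constant in the induction; [tcoef]
    vanishes when k + j > n. *)
Lemma thvec_expand N n : (n < N)%N ->
  thvec n = \sum_(k < N) \sum_(j < N) tcoef n k j *: dvec n k j.
Proof.
elim: n => [|n IH] nN.
  case: N nN => // N _.
  have t00 k j : tcoef 0 k j = ((k == 0) && (j == 0))%N%:R.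
    rewrite /tcoef /qtri leqn0 addn_eq0; case: k j => [|k] [|j]; rewrite /= ?mulr0 //.
    rewrite /qfact !big_nil ?(muln0, addn0, bin0n, expr0, expr1n, mulr1, mul1r, divr1, invr1).
    by [].
  rewrite big_ord_recl big_ord_recl t00 /= scale1r !big1 ?addr0 // => i _.
    by rewrite big1 // => j _; rewrite t00 scale0r.
  by rewrite t00 scale0r.
have nN' := ltnW nN; rewrite /= GopE thvec_E1 IH //.
pose T1 (k j : nat) := tcoef n k j *: dvec n.+1 k j.
pose T2 k j : V := if k is k'.+1 then (ck n k' * tcoef n k' j) *: dvec n.+1 k j else 0.
pose T3 k j : V := if j is j'.+1 then (cj n k * tcoef n k j') *: dvec n.+1 k j else 0.
have t0 k j : (n < k + j)%N -> tcoef n k j = 0.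
  by move=> h; rewrite /tcoef /qtri leqNgt h mulr0.
transitivity (\sum_(k < N) \sum_(j < N) (T1 k j + T2 k.+1 j + T3 k j.+1)).
  pose H x := F2 x - (s_ n * (1 - q ^+ 2)^-1) *:
    (d ^+ 2 *: F3 q A (alpha *: x) - (q^-1 * d) *: F2 (K1i x)).
  have Hl : lin H.
    move=> t x y; rewrite /H !(linopD F3_lin, linopZ F3_lin, opD, opZ); lincomb C V; ring.
  rewrite -/(H _) (linop_sum Hl); apply: eq_bigr => k _; rewrite (linop_sum Hl).
  apply: eq_bigr => j _; rewrite (linopZ Hl) /T1 /T2 /T3.
  have [h|h] := leqP (k + j) n; last by rewrite t0 // !mulr0 !scale0r !addr0.
  have kn : (k <= n)%N := leq_trans (leq_addr _ _) h.
  have [eF e3 eK] := dvec_step j kn; rewrite /H (linopZ F3_lin) eF e3 eK.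
  have e : q^-1 ^+ (n - k) = q ^+ k / q ^+ n.
    rewrite exprVn; apply: invr_inj; rewrite invrK invfM invrK mulrC.
    by apply: (mulIf (expf_neq0 k q0)); rewrite -exprD subnK // mulfVK ?expf_neq0.
  have es : s_ n = q ^+ (2 * m) / (q ^+ 2 * q ^+ n * kappa).
    have -> : q ^ (1 - n%:Z) = q / q ^+ n by rewrite expfzDr // exprnN.
    have -> : sing_param m = q ^+ 3 / q ^+ (2 * m) * kappa.
      by rewrite /sing_param expfzDr // (_ : - (2 * m%:Z) = - (2 * m)%N%:Z) -?exprnN.
    by field; rewrite !expf_neq0 // q0 kappa0.
  have e2 : q ^+ (2 * n) = q ^+ n ^+ 2 by rewrite mulnC exprM.
  have e2k : q ^+ (2 * k) = q ^+ k ^+ 2 by rewrite mulnC exprM.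
  have n1 : 1 - q ^+ 2 != 0 by rewrite -opprB oppr_eq0 q21_neq0.
  rewrite /ck /cj e es e2 e2k; move: (tcoef n k j) (q ^+ (2 * m)) => t S.
  move: (q ^+ n) (expf_neq0 n q0) (q ^+ k) => Q Q0 K.
  lincomb C V; field; rewrite -?expr2 ?q0 ?Q0 ?kappa0 ?n1 //.
rewrite [LHS](eq_bigr (fun k : 'I_N =>
    \sum_(j < N) (T1 k j + T3 k j.+1) + \sum_(j < N) T2 k.+1 j)); last first.
  by move=> k _; rewrite -big_split; apply: eq_bigr => j _ /=; rewrite addrAC.
rewrite big_split /= (@sum_shift _ N (fun k => \sum_(j < N) T2 k j)); first last.
- rewrite big1 // => j _; case: N {IH} nN nN' j => // N nN _ j /=.
  by rewrite t0 ?mulr0 ?scale0r // (leq_trans _ (leq_addr _ _)).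
- by rewrite big1.
rewrite -big_split /=; apply: eq_bigr => k _.
rewrite big_split /= (@sum_shift _ N (T3 k)) //; last first.
  case: N {IH} nN nN' k => // N nN _ k /=.
  by rewrite t0 ?mulr0 ?scale0r // (leq_trans _ (leq_addl _ _)).
rewrite -!big_split /=; apply: eq_bigr => j _.
rewrite tcoef_rec /T1 /T2 /T3 !scalerDl addrAC.
by congr (_ + _ + _); case: (nat_of_ord _) => [|?]; rewrite ?scale0r.
Qed.
Lemma acoef_exponent k j :
  q ^ (j%:Z * (m%:Z - 3)) * q ^ (divz (k%:Z * (2 * m%:Z + 2 * j%:Z + k%:Z - 7)) 2) =
  q ^+ m ^+ (k + j) * q ^+ (k * j) * q ^+ 'C(k, 2) / q ^+ (3 * (k + j)).
Proof.
(* The numerator of the exponent is even because k (k - 1) is. *)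
have kC : (k%:Z * (k%:Z - 1) = 2 * ('C(k, 2))%:Z)%R.
  elim: k => [|k IH]; first by rewrite mul0r.
  by rewrite binS bin1 PoszD [in RHS]mulrDr -IH intS; ring.
have -> : k%:Z * (2 * m%:Z + 2 * j%:Z + k%:Z - 7) =
    (k%:Z * (m%:Z + j%:Z) + ('C(k, 2))%:Z - 3 * k%:Z) * 2 :> int.
  have -> : (k%:Z * (m%:Z + j%:Z) + ('C(k, 2))%:Z - 3 * k%:Z) * 2 =
      k%:Z * (m%:Z + j%:Z) * 2 + 2 * ('C(k, 2))%:Z - 6 * k%:Z :> int by ring.
  by rewrite -kC; ring.
rewrite mulzK // -exprM exprnN !exprnP -!expfzDr //.
by congr (q ^ _); rewrite !PoszM !PoszD; ring.
Qed.

Lemma u_vec_thvec : u_vec q alpha A m v = thvec m.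
Proof.
rewrite (thvec_expand (ltnSn m)) /u_vec; apply: eq_bigr => k _.
have km : (k <= m)%N by rewrite -ltnS.
have ki : kappa^-1 != 0 by rewrite invr_eq0.
have Ki n : iter n (Kinv A) v = kappa^-1 ^+ n *: v.
  have Kv : Kinv A v = kappa^-1 *: v.
    rewrite /Kinv !kk; apply: (scalerI kappa0); rewrite scalerA divff // scale1r -!opZ.
    by case: hv => _ _ <- _; rewrite /Defs.Kop !kk.
  elim: n => [|n IH]; first by rewrite scale1r.
  have Kil : lin (Kinv A) by move=> t x y; rewrite /Kinv !lins.
  by rewrite iterS IH (linopZ Kil) Kv scalerA -exprSr.
rewrite (big_ord_widen m.+1 (fun j => acoef q alpha m k j *: iter (m - k) F2
    (iter k (F3 q A) (iter (2 * j) K2 (iter (2 * j + k) (Kinv A) v))))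
  (leq_subr k m : ((m - k).+1 <= m.+1)%N)).
rewrite big_mkcond; apply: eq_bigr => j _; rewrite ltnS leq_subRL //.
case: leqP => h; last by rewrite /tcoef /qtri leqNgt h mulr0 scale0r.
rewrite Ki (linopZ (iter_lin (lin_K2 HA) _)) (linopZ (iter_lin F3_lin _)).
rewrite (linopZ (iter_lin (lin_F2 HA) _)) scalerA -/(dvec m k j); congr (_ *: _).
rewrite /acoef /tcoef -qtri_binom //.
have -> : q ^+ (2 * m) / q ^+ m = q ^+ m.
  by rewrite mulnC exprM expr2 mulfK ?expf_neq0.
rewrite -[_ * q ^ _ * q ^ _]mulrA acoef_exponent !exprMn !exprVn [kappa ^+ (_ + _)]exprD.
rewrite invfM; ring.
Qed.

Lemma u_vec_sing_vec : exists2 t, t != 0 & u_vec q alpha A m v = t *: sing_vec m.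
Proof. by rewrite u_vec_thvec; exact: thvec_rung. Qed.
End SingularVector.

End HighestVector.
End ModuleRelations.

(** * The lattice of submodules *)

Section Submodules.
Variables (C : numClosedFieldType) (q alpha kappa c : C) (V : lmodType C) (A : Uops V) (v : V).
Hypotheses (q0 : q != 0) (qroot : forall m, (0 < m)%N -> q ^+ m != 1).
Hypotheses (HA : Uq_module q A) (alpha0 : alpha != 0) (kappa0 : kappa != 0).
Hypothesis hV : is_V q alpha kappa c A v.
Local Notation w := (wvec A v).
Local Notation act := (pact (Xop q A)).
Local Notation u := (sing_vec q A kappa v).
Local Notation crit n := (hn q kappa c n = 0).

Let hv : highest_rel q A alpha kappa c v. Proof. by case: hV. Qed.
Let cyc y : gen A v y. Proof. by case: hV. Qed.

(** The universal property maps V to the PBW model. There, by [mX_iter_F2], the leading coefficient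
    of f, of degree d, is detected at F_2^(n-d) G^d v. *)
Lemma act_wvec_inj n (f : {poly C}) : (size f <= n.+1)%N -> act f (w n) = 0 -> f = 0.
Proof.
move=> fn z; have q2 := q21_neq0 qroot.
have mH := mops_Uq_module c q0 q2 alpha0 kappa0.
case: hV => _ _ /(_ _ _ mH _ (mv_highest c q0 q2 alpha0 kappa0)).
case=> phi [[pl pE pK] pv].
have pX x : phi (Xop q A x) = mX q c (phi x).
  rewrite -(mC1opE c q0 q2 alpha0 kappa0) /Xop -lock (linopZ pl) /C1op.
  rewrite !(linopD pl, linopZ pl); case: (pE (E1 A x)) => _ _ -> _; case: (pE x) => -> _ _ _.
  by case: (pK x) => -> -> _ _.
have pw : phi (w n) = iter n (mF2 q) (mv C).
  rewrite /wvec; elim: n {fn z} => [|n IH] //; rewrite !iterS -IH.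
  by case: (pE (iter n (F2 A) v)).
have pi i : phi (iter i (Xop q A) (w n)) = iter i (mX q c) (iter n (mF2 q) (mv C)).
  by elim: i => // i IH; rewrite !iterS pX IH.
apply/eqP; rewrite -lead_coef_eq0 lead_coefE; apply/eqP.
have [->|f0] := eqVneq f 0; first by rewrite coef0.
have sf : (size f).-1.+1 = size f by rewrite prednK // size_poly_gt0.
have dn : ((size f).-1 <= n)%N by rewrite -ltnS sf.
have := congr1 phi z; rewrite (linop_sum pl) (linop0 pl).
move/(congr1 (fun g : mcarrier C => g 0 (n%:Z - (size f).-1%:Z) (size f).-1%:Z)).
have sE (I : finType) (F : I -> mcarrier C) i j k : (\sum_t F t) i j k = \sum_t F t i j k.
  by elim/big_rec2: _ => // t y1 y2 _ <-.
rewrite sE -sf big_ord_recr /= big1 ?add0r => [|i _].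
  rewrite (linopZ pl) pi => /eqP; rewrite mulf_eq0.
  case: (mX_iter_F2 c q0 q2 qroot dn) => /negPf nz _; rewrite nz orbF => /eqP.
  by [].
rewrite (linopZ pl) pi; have [_ zz] := mX_iter_F2 c q0 q2 qroot (leq_trans (ltnW (ltn_ord i)) dn).
by rewrite mZE zz ?mulr0.
Qed.

(** By [gen_wspan] applied to the singular vector, the submodule is spanned by vectors of degree at
    least m + 1, and different degrees are independent. *)
Lemma gen_sing_vec_low m k f : crit m.+1 -> (k <= m)%N -> gen A (u m.+1) (act f (w k)) ->
  act f (w k) = 0.
Proof.
move=> hm km; have hu := sing_vec_highest q0 qroot HA alpha0 kappa0 hv hm.
have k0 : Kweight q kappa m.+1 != 0 by rewrite mulf_neq0 ?invr_eq0 ?expf_neq0.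
have wE n : exists g, wvec A (u m.+1) n = act g (w (n + m.+1)).
  elim: n => [|n [g IH]]; first by exists (rung q (sing_param q kappa m.+1) m.+1 m.+1).
  have [a [b [Fa _ _]]] := F2_act q0 qroot HA hv g (n + m.+1).
  by exists a; rewrite /wvec iterS -/(wvec A _ n) IH Fa.
(* The polynomial 0 is allowed in every degree, as [wspan_homogeneous] requires. *)
pose Q n (g : {poly C}) := (m < n)%N \/ g = 0.
move=> /(gen_wspan q0 qroot HA alpha0 k0 hu) [s _ e].
have : wspan q A v Q (act f (w k)).
  rewrite e; elim: s {e} => [|[[n l] g] s IH]; first by rewrite big_nil; apply: wspan0.
  rewrite big_cons; apply: wspanD IH; have [g' eg] := wE n.
  rewrite /tm /= eg -(pactM (Xop_lin q0 qroot HA)).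
  by apply: (@wspan_tm _ q V A v Q (n + m.+1) l); left; rewrite addnS ltnS leq_addl.
have Q0 : Q k 0 by right.
have QD g h : Q k g -> Q k h -> Q k (g + h).
  by case=> [?|->]; [left | case=> [?|->]; [left | right; rewrite addr0]].
case/(wspan_homogeneous q0 qroot HA alpha0 kappa0 hv Q0 QD) => g Qg ->.
by case: Qg => [|->]; [rewrite ltnNge km | rewrite pact0].
Qed.

(** By [first_degree], the first degree where S is nonzero is 0, where f(X) v is a multiple of v, or
    is critical and brings its singular vector into S. *)
Lemma submod_trivial (S : V -> Prop) N : submod A S -> ~ S v ->
  (forall k, (0 < k < N)%N -> crit k -> ~ S (u k)) ->
  forall k f, (k < N)%N -> S (act f (w k)) -> act f (w k) = 0.
Proof.
move=> HS nv H; elim=> [|k IH] f kN Sf.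
  move: Sf; rewrite -[w 0]/v (act_v q0 qroot HA hv).
  have [->|fc] := eqVneq f.[(q - q^-1) ^+ 2 * c] 0; first by rewrite scale0r.
  by move/(subZr HS fc).
have [//|/eqP nz] := eqVneq (act f (w k.+1)) 0.
have [h Su] := first_degree q0 qroot HA alpha0 kappa0 hv act_wvec_inj HS (fun g => IH g (ltnW kN)) Sf nz.
by case: (H k.+1 kN h Su).
Qed.

Variables (nplus nminus : nat).
Hypotheses (nm0 : (0 < nminus)%N) (critm : crit nminus) (critp : crit nplus).
Hypothesis critE : forall m, (0 < m)%N -> crit m -> (nminus <= m <= nplus)%N.

Lemma crit_two k : (0 < k)%N -> crit k -> k = nminus \/ k = nplus.
Proof.
move=> k0 hk; have [->|/eqP km] := eqVneq k nminus; first by left.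
have [mp|/eqP mp] := eqVneq nminus nplus.
  by case: km; have := critE k0 hk; rewrite -mp -eqn_leq => /eqP.
right; apply: (sing_param_inj q0 qroot kappa0).
apply: (mulIf (sing_param_neq0 q0 kappa0 nminus)).
rewrite (hn_two q0 qroot kappa0 hk critm km) (hn_two q0 qroot kappa0 critp critm) //.
by move=> e; apply: mp.
Qed.

Let np0 : (0 < nplus)%N.
Proof. by have /andP[_] := critE nm0 critm; apply: leq_trans. Qed.
Let mp : (nminus <= nplus)%N.
Proof. by have /andP[_] := critE nm0 critm. Qed.

(** There is no critical degree below n_-, so S is zero there and [submod_contained] applies. *)
Lemma proper_sub_minus S : submod A S -> ~ S v -> psubset S (gen A (u nminus)).
Proof.
move=> HS nv x Sx; have e := prednK nm0; rewrite -e.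
apply: (submod_contained (S := S) q0 qroot HA alpha0 kappa0 hv act_wvec_inj) => //; rewrite ?e //.
move=> k f kn; apply: (submod_trivial (N := nminus) HS nv); last by rewrite -e ltnS.
by move=> j /andP[j0 jn] /(critE j0)/andP[]; rewrite leqNgt jn.
Qed.

Lemma sub_plus S : submod A S -> ~ S v -> ~ S (u nminus) -> psubset S (gen A (u nplus)).
Proof.
move=> HS nv nu x Sx; have e := prednK np0; rewrite -e.
apply: (submod_contained (S := S) q0 qroot HA alpha0 kappa0 hv act_wvec_inj) => //; rewrite ?e //.
move=> k f kn; apply: (submod_trivial (N := nplus) HS nv); last by rewrite -e ltnS.
by move=> j /andP[j0 jn] /(crit_two j0)[->//|jp]; move: jn; rewrite jp ltnn.
Qed.

Lemma uplus_minus : gen A (u nminus) (u nplus).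
Proof.
move: mp; rewrite leq_eqVlt => /orP[/eqP->|lt]; first exact: gen_id.
exact: (sing_vec_chain q0 qroot HA kappa0 hv lt critp critm).
Qed.

(** If u_+ were not in S, neither would u_- or v be, and S would be zero in every degree. *)
Lemma nonzero_uplus S : submod A S -> (exists y, S y /\ y <> 0) -> S (u nplus).
Proof.
move=> HS [y [Sy y0]]; apply: contrapT => nu; apply: y0.
have nm : ~ S (u nminus) by move=> Sm; apply: nu; apply: uplus_minus Sm.
have nv : ~ S v by move=> Sv; apply: nu; apply: cyc Sv.
apply: (submod_compare q0 qroot HA alpha0 kappa0 hv HS (submod0 HA)) Sy.
  move=> n f; apply: (submod_trivial (N := n.+1) HS nv) => // k /andP[k0 _].
  by case/(crit_two k0) => ->.
exact: (gen_wspan q0 qroot HA alpha0 kappa0 hv).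
Qed.

Lemma v_notin n : (0 < n)%N -> crit n -> ~ gen A (u n) v.
Proof.
move=> n0 h gv; have e := prednK n0; rewrite -e in h gv.
have := @gen_sing_vec_low _ 0 1 h (leq0n _); rewrite pact1 => /(_ gv) v0.
have H := @act_wvec_inj 0 1; rewrite pact1 size_poly1 in H.
by have /eqP := H isT v0; rewrite oner_eq0.
Qed.

Lemma uminus_notin : (nminus < nplus)%N -> ~ gen A (u nplus) (u nminus).
Proof.
move=> lt gu; have e := prednK np0; rewrite -e in gu.
apply: (sing_vec_neq0 (m := nminus) act_wvec_inj).
apply: gen_sing_vec_low gu; rewrite ?e //.
by rewrite -ltnS e.
Qed.
End Submodules.

Lemma gen_scale (C : fieldType) (V : lmodType C) (A : Uops V) (t : C) (x : V) :
  t != 0 -> gen A (t *: x) = gen A x.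
Proof.
move=> t0; apply/funext => y; apply/propext; split=> H S HS Sx; apply: H => //.
  by case: HS => _ _ SZ _ _; apply: SZ.
by case: HS => _ _ /(_ t^-1 _ Sx); rewrite scalerA mulVf ?scale1r.
Qed.

(* C = R[i] with R the (unique) real numbers; n_+ = nplus, n_- = nminus. *)
Theorem theorem5p6 (R : realType) (q alpha kappa c : R[i]) (nplus nminus : nat)
  (V : lmodType R[i]) (A : Uops V) (v : V) :
  q != 0 -> (forall m : nat, (0 < m)%N -> q ^+ m != 1) -> alpha != 0 ->
  kappa != 0 ->
  (0 < nminus)%N -> hn q kappa c nminus = 0 -> hn q kappa c nplus = 0 ->
  (forall m : nat, (0 < m)%N -> hn q kappa c m = 0 -> (nminus <= m <= nplus)%N) ->
  Uq_module q A -> is_V q alpha kappa c A v ->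
  let Wplus := gen A (u_vec q alpha A nplus v) in
  let Wminus := gen A (u_vec q alpha A nminus v) in
  [/\ is_maximal A Wminus,
      is_minimal A Wplus,
      (nplus = nminus ->
         pequiv Wplus Wminus /\
         forall T, nonzero_proper A T <-> pequiv T Wplus) &
      ((nminus < nplus)%N ->
         [/\ psubset Wplus Wminus, ~ psubset Wminus Wplus &
             forall T, nonzero_proper A T <-> (pequiv T Wplus \/ pequiv T Wminus)])].
Proof.
move=> q0 qroot alpha0 kappa0 nm0 critm critp critE HA hV.
have [hv cyc _] := hV.
(* From here on u_+ and u_- are replaced by singular vectors, to which they are proportional with
   nonzero factors. *)
have [tp tp0 ->] := u_vec_sing_vec q0 qroot HA kappa0 hv critp.
have [tm tm0 ->] := u_vec_sing_vec q0 qroot HA kappa0 hv critm.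
rewrite !gen_scale //; set up := sing_vec _ _ _ _ nplus; set um := sing_vec _ _ _ _ nminus => Wp Wm.
have np0 : (0 < nplus)%N by have /andP[_] := critE _ nm0 critm; apply: leq_trans.
have subm := proper_sub_minus q0 qroot HA alpha0 kappa0 hV nm0 critm critE.
have subp := sub_plus q0 qroot HA alpha0 kappa0 hV nm0 critm critp critE.
have nzp := nonzero_uplus q0 qroot HA alpha0 kappa0 hV nm0 critm critp critE.
have pm : gen A um up := uplus_minus q0 qroot HA kappa0 hV nm0 critm critp critE.
have vm : ~ Wm v := v_notin q0 qroot HA alpha0 kappa0 hV nm0 critm.
have vp : ~ Wp v := v_notin q0 qroot HA alpha0 kappa0 hV np0 critp.
have ind := act_wvec_inj q0 qroot alpha0 kappa0 hV.
have up0 : up <> 0 := sing_vec_neq0 (m := nplus) ind.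
have um0 : um <> 0 := sing_vec_neq0 (m := nminus) ind.
have Wps : submod A Wp := gen_submod A up.
have Wms : submod A Wm := gen_submod A um.
have Wpp : Wp up by move=> S _.
have Wmm : Wm um by move=> S _.
have gle S x : submod A S -> S x -> psubset (gen A x) S by move=> HS Sx y; apply.
have np_eq S T : pequiv T S -> nonzero_proper A S -> nonzero_proper A T.
  move=> e; have -> // : T = S by apply/funext => y; apply/propext.
have npp : nonzero_proper A Wp by split=> //; [exists up | exists v].
have npm : nonzero_proper A Wm by split=> //; [exists um | exists v].
split.
- split=> //; first by exists v.
  move=> T HT mT; have [Tv|nv] := EM (T v); first by right=> y; apply: cyc.
  by left=> y; split; [apply: subm | apply: mT].
- split=> //; first by exists up.
  move=> T HT Tp; have [ex|nex] := EM (exists y, T y /\ y <> 0).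
    by right=> y; split; [apply: Tp | apply: gle => //; apply: nzp].
  left=> y; split=> [Ty|->]; last by case: HT.
  by apply: contrapT => y0; apply: nex; exists y.
- move=> e; have epm : Wp = Wm by rewrite /Wp /Wm /up /um e.
  split=> [|T]; first by rewrite epm.
  split=> [[HT ex [y ny]] x|/np_eq]; last exact.
  split=> [|Wx]; last by apply: gle Wx => //; apply: nzp.
  rewrite epm; apply: subm => //; by move=> Tv; apply: ny; apply: cyc.
- move=> lt; have nmp := uminus_notin q0 qroot HA alpha0 kappa0 hV nm0 critm critp critE lt.
  split=> [|H|T]; first exact: gle.
    by apply: nmp; apply: H.
  split=> [[HT ex [y ny]]|[]/np_eq]; try exact.
  have nv : ~ T v by move=> Tv; apply: ny; apply: cyc.
  have [Tm|nTm] := EM (T um); [right|left] => x; split.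
  + exact: subm.
  + exact: gle.
  + exact: subp.
  + by apply: gle => //; apply: nzp.
Qed.
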